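(* Let $S(X)$ be the set of square-free integers between $1$ and $X$, and let $S(X;c,k)$ be the number of square-free integers between $1$ and $X$ that are congruent to $c$ modulo $k$. Let $\overline{\mathfrak D^0}$ and $\overline{\mathfrak D^1}$ be the sets of leasts to $0$ and leasts to $1$ defined in the context. Then $$\lim_{X\to\infty}\frac{|S(X)\cap\overline{\mathfrak D^0}|}{|S(X)|}=\lim_{X\to\infty}\frac{|S(X)\cap\overline{\mathfrak D^1}|}{S(X;1,4)}=1.$$ In particular, almost all real quadratic number fields are of the least type; that is, the number of square-free integers $1<d\le N$ such that $\mathbb Q(\sqrt d)$ is not of the least type, divided by $N$, tends to $0$ as $N\to\infty$.
   Context: For a positive non-square integer $d$, $\omega_d=\frac{1+\sqrt d}2$ if $d\equiv1\pmod 4$ and $\omega_d=\sqrt d$ otherwise. For a quadratic irrational $\alpha$ with eventually periodic simple continued fraction, $l(\alpha)$ denotes its minimal period. Let $\mathfrak I$ be the set of pairs $(y,x)$ of integers with $y>0$, $0\le x<y$ and $x^2\equiv1\pmod y$ or $x^2\equiv-1\pmod y$. For $(y,x)\in\mathfrak I$, $\mathfrak D^0(y,x)$ is the set of all positive non-square integers $d$ of one of the following forms: - (case 1) if $x^2\equiv-1\pmod y$: $d=a_0^2+\frac{2x}{y}a_0+\frac{x^2+1}{y^2}$, where $a_0$ runs over the positive integers with $2a_0\equiv x\frac{1+x^2}{y}\pmod y$; - (case 2) if $x^2\equiv1\pmod y$: $d=a_0^2+\frac{2x}{y}a_0+\frac{x^2-1}{y^2}$, where $a_0$ runs over the positive integers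 with $2a_0\equiv x\frac{1-x^2}{y}\pmod y$. Similarly $\mathfrak D^1(y,x)$ is the set of all positive non-square integers $d$ of one of the following forms: - (case 3) if $x^2\equiv-1\pmod y$: $d=(2a_0-1)^2+\frac{4x}{y}(2a_0-1)+\frac{4x^2+4}{y^2}$, where $a_0$ runs over the positive integers with $2a_0\equiv1+x\frac{1+x^2}{y}\pmod y$; - (case 4) if $x^2\equiv1\pmod y$: $d=(2a_0-1)^2+\frac{4x}{y}(2a_0-1)+\frac{4x^2-4}{y^2}$, where $a_0$ runs over the positive integers with $2a_0\equiv1+x\frac{1-x^2}{y}\pmod y$. (These are integers, those in $\mathfrak D^1(y,x)$ being $\equiv1\pmod4$. Each set may be empty. Only for $y\le2$ can $x$ satisfy both congruences; then all elements from either case are included.) For $(y,x)\in\mathfrak I$ write $x/y=[0,a_1,\dots,a_n]$ with $\{a_1,\dots,a_n\}$ a symmetric (palindromic) sequence of positive integers, where $n$ is even in cases 1 and 3 and odd in cases 2 and 4 (for $(y,x)=(1,0)$ take $n=0$). Let $\overline{\mathfrak D^i}(y,x)$ be $\mathfrak D^i(y,x)$ with its least element removed if the period of that least element $d$ (meaning $l(\sqrt d)$ for $i=0$ and $l(\omega_d)$ for $i=1$) is less than $n+1$; otherwise $\overline{\mathfrak D^i}(y,x)=\mathfrak D^i(y,x)$. A positive non-square integer $d$ is called a least to $i$ ($i=0,1$) if $d$ is the smallest element of $\overline{\mathfrak D^i}(y,x)$ for some $(y,x)\in\mathfrak I$. $\overline{\mathfrak D^i}$ is the set of all leasts to $i$.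 For square-free $d>1$, the field $\mathbb Q(\sqrt d)$ is of the least type if either $d\equiv2,3\pmod4$ and $d\in\overline{\mathfrak D^0}$, or $d\equiv1\pmod4$ and $d\in\overline{\mathfrak D^1}$. *)

(* Defs.v *)
From HB Require Import structures.
From mathcomp Require Import all_boot all_order all_algebra finmap.
From mathcomp Require Import all_classical all_reals all_analysis.

Set Implicit Arguments.
Unset Strict Implicit.
Unset Printing Implicit Defensive.

Import Order.TTheory GRing.Theory Num.Theory.
Import numFieldNormedType.Exports.

Local Open Scope classical_set_scope.
Local Open Scope ring_scope.

Definition nonsquare (d : nat) : Prop := forall m : nat, d <> (m ^ 2)%N.

Definition squarefree (d : nat) : Prop :=
  forall m : nat, (m ^ 2 %| d)%N -> m = 1%N.

Definition least_elt (A : set nat) (d : nat) : Prop :=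
  A d /\ forall d', A d' -> (d <= d')%N.

(** Regular continued fraction of a real number: complete and partial
    quotients.  (After a zero fractional part the complete quotients are
    [0^-1 = 0]; this never happens for an irrational [alpha].) *)
Fixpoint complete_quotient (R : realType) (alpha : R) (k : nat) : R :=
  if k is k'.+1 then
    let t := complete_quotient alpha k' in (t - (Num.floor t)%:~R)^-1
  else alpha.

Definition partial_quotient (R : realType) (alpha : R) (k : nat) : int :=
  Num.floor (complete_quotient alpha k).

Definition eventual_period (R : realType) (alpha : R) (l : nat) : Prop :=
  (0 < l)%N /\
  exists N : nat, forall k, (N <= k)%N ->
    partial_quotient alpha (k + l) = partial_quotient alpha k.

(** The minimal period; [0] if the expansion is not eventually periodic. *)
Definition period (R : realType) (alpha : R) : nat :=
  xget 0%N [set l | eventual_period alpha l /\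
                    forall m, eventual_period alpha m -> (l <= m)%N].

Definition omega (R : realType) (d : nat) : R :=
  if (d %% 4 == 1)%N then (1 + Num.sqrt d%:R) / 2 else Num.sqrt d%:R.

(** [cf0 [:: a_1; ...; a_n]] is [[0, a_1, ..., a_n]]. *)
Fixpoint cf0 (s : seq nat) : rat :=
  if s is a :: s' then (a%:R + cf0 s')^-1 else 0.

Definition pairsI (y x : int) : Prop :=
  [/\ 0 < y, 0 <= x, x < y &
      (x ^+ 2 = 1 %[mod y])%Z \/ (x ^+ 2 = - 1 %[mod y])%Z].

(** In the four sets below the integer quotients by [y] are exact, because of
    the congruence assumed on [x ^+ 2]; the suffix [m] or [p] records whether
    [x ^+ 2] is congruent to [-1] or to [1]. *)
Definition D0m (y x : int) : set nat := [set d | [/\ (0 < d)%N, nonsquare d,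
  (x ^+ 2 = - 1 %[mod y])%Z & exists a0 : int, [/\ 0 < a0,
    (2 * a0 = x * ((1 + x ^+ 2) %/ y)%Z %[mod y])%Z &
    d%:R = a0%:Q ^+ 2 + 2 * x%:Q / y%:Q * a0%:Q
           + (x%:Q ^+ 2 + 1) / y%:Q ^+ 2 ]]].

Definition D0p (y x : int) : set nat := [set d | [/\ (0 < d)%N, nonsquare d,
  (x ^+ 2 = 1 %[mod y])%Z & exists a0 : int, [/\ 0 < a0,
    (2 * a0 = x * ((1 - x ^+ 2) %/ y)%Z %[mod y])%Z &
    d%:R = a0%:Q ^+ 2 + 2 * x%:Q / y%:Q * a0%:Q
           + (x%:Q ^+ 2 - 1) / y%:Q ^+ 2 ]]].

Definition D1m (y x : int) : set nat := [set d | [/\ (0 < d)%N, nonsquare d,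
  (x ^+ 2 = - 1 %[mod y])%Z & exists a0 : int, [/\ 0 < a0,
    (2 * a0 = 1 + x * ((1 + x ^+ 2) %/ y)%Z %[mod y])%Z &
    d%:R = (2 * a0%:Q - 1) ^+ 2 + 4 * x%:Q / y%:Q * (2 * a0%:Q - 1)
           + (4 * x%:Q ^+ 2 + 4) / y%:Q ^+ 2 ]]].

Definition D1p (y x : int) : set nat := [set d | [/\ (0 < d)%N, nonsquare d,
  (x ^+ 2 = 1 %[mod y])%Z & exists a0 : int, [/\ 0 < a0,
    (2 * a0 = 1 + x * ((1 - x ^+ 2) %/ y)%Z %[mod y])%Z &
    d%:R = (2 * a0%:Q - 1) ^+ 2 + 4 * x%:Q / y%:Q * (2 * a0%:Q - 1)
           + (4 * x%:Q ^+ 2 - 4) / y%:Q ^+ 2 ]]].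

(** The index [i] of the sets is a boolean, [false] for 0 and [true] for 1.
    The boolean [par] is the parity of the length [n] of the symmetric
    sequence: [n] is even if [x ^+ 2] is [-1] and odd if it is [1]. *)
Definition Dcase (i par : bool) : int -> int -> set nat :=
  match i, par with
  | false, false => D0m
  | false, true => D0p
  | true, false => D1m
  | true, true => D1p
  end.

Definition Dset (i : bool) (y x : int) : set nat :=
  Dcase i false y x `|` Dcase i true y x.

Definition symmetric_length (par : bool) (y x : int) (n : nat) : Prop :=
  if (y == 1) && (x == 0) then n = 0%N else
  exists a : seq nat,
    [/\ size a = n, odd n = par, all (fun k => 0 < k)%N a, rev a = a &
        x%:Q / y%:Q = cf0 a].

Definition periodD (R : realType) (i : bool) (d : nat) : nat :=
  if i then period (omega R d) else period (Num.sqrt d%:R : R).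

(** The parity of [n] is that of the case which the least element [d] comes
    from.  Only for [y <= 2] may both congruences hold: for [(y, x) = (1, 0)],
    [n = 0] in either case; for [(2, 1)], one of the two cases is empty (the
    first for [i = 0], the second for [i = 1]). *)
Definition removed (R : realType) (i : bool) (y x : int) (d : nat) : Prop :=
  least_elt (Dset i y x) d /\
  exists (par : bool) (n : nat),
    [/\ Dcase i par y x d, symmetric_length par y x n &
        (periodD R i d < n + 1)%N].

Definition Dbar (R : realType) (i : bool) (y x : int) : set nat :=
  Dset i y x `\` [set d | removed R i y x d].

Definition leasts (R : realType) (i : bool) : set nat :=
  [set d | exists y x : int, pairsI y x /\ least_elt (Dbar R i y x) d].

(** The field [Q(sqrt d)] is represented by its squarefree [d > 1]. *)
Definition least_type (R : realType) (d : nat) : Prop :=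
  ((d %% 4 = 2 \/ d %% 4 = 3)%N /\ leasts R false d) \/
  ((d %% 4 = 1)%N /\ leasts R true d).

Definition sqfree_upto (R : realType) (X : R) : set nat :=
  [set d | [/\ (1 <= d)%N, d%:R <= X & squarefree d]].

Definition ncard (A : set nat) : nat := #|` fset_set A|.

Definition sqfree_count (R : realType) (X : R) (c k : nat) : nat :=
  ncard [set d | sqfree_upto X d /\ d = c %[mod k]].

(* Main.v *)
Require Import Defs.
From HB Require Import structures.
From mathcomp Require Import all_boot all_order all_algebra finmap.
From mathcomp Require Import all_classical all_reals all_analysis.
From mathcomp Require Import zify ring lra.

(** Why almost every discriminant is a least.  Let [d] be a non-square and put
    [theta = a0 + sqrt d] with [a0] the integral part of [sqrt d] (for [i = 0]),
    or [theta = a0 - 1 + omega] with [a0] the integral part of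
    [omega = (1 + sqrt d) / 2] (for [i = 1] and [d] congruent to 1 modulo 4).
    Then [theta] is larger than 1 and its conjugate lies between -1 and 0, so
    its continued fraction is purely periodic.  If [l] is the period, the
    continuants of one period are integers [x <= y] with
    [x / y = [0, a_(l-1), .., a_1]] for which [y theta + x] is a unit of norm
    [(-1)^l].  Written out, this norm equation says that [d] belongs to the
    family [D^i(y, x)], with the parameter [a0] ([omega_period_unit],
    [norm_eq_congr]).

    In [D^i(y, x)] the discriminant is an increasing function of [a0], and
    [2 a0] is prescribed modulo [y].  Hence [d] is the smallest element as soon
    as [2 a0 < y].  It is not removed either, since a rational number has at most
    one expansion length of a given parity, which makes [n + 1] equal to the
    period ([leasts_intro]).  So [d] can fail to be a least only when its unit
    is small: [y <= 2 a0], which is about [2 sqrt d] at most.  Then [d] satisfies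
    [T^2 - d Y^2 = c] with [c] among 1, -1, 4, -4, with [T] and [Y] coprime and
    [Y^2 <= 18 d] ([leasts_or_small_pell]).

    Such [d] are rare.  For given [Y] and [c], [T] is a square root of [c] modulo
    [Y^2], and [T] is bounded by about [sqrt N * Y] when [d <= N].  There are
    [O(tau(Y)) = O(sqrt Y)] square roots modulo [Y^2] ([count_square_roots]), so
    [O(sqrt N / sqrt Y)] values of [T]; the sum over [Y = O(sqrt N)] is
    [O(N^(3/4))] ([count_small_pell_le]).

    On the other hand the squarefree integers congruent to 1 modulo 4 have
    positive lower density, because the inverse squares of the odd integers
    [m >= 3] add up to at most 1/4 ([count_sqfree_1mod4_ge]).  The exceptions
    are thus negligible in front of each of the three denominators. *)

Set Implicit Arguments.
Unset Strict Implicit.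
Unset Printing Implicit Defensive.

Import Order.TTheory GRing.Theory Num.Theory.
Import numFieldNormedType.Exports.

Local Open Scope classical_set_scope.
Local Open Scope ring_scope.

(** * Quadratic surds and the states of their expansion *)

Lemma sqrt_nonsquare_irrational (R : realType) (d : nat) (a b : int) :
  nonsquare d -> b%:~R * Num.sqrt (d%:R : R) = a%:~R -> b = 0.
Proof.
move=> nsd bs; apply/eqP; case: eqVneq => // b0; exfalso.
have : (b ^+ 2 * d%:Z)%:~R = (a ^+ 2)%:~R :> R.
  by rewrite rmorphM !rmorphXn /= -bs exprMn sqr_sqrtr.
move/intr_inj => /(congr1 absz); rewrite abszM !abszX absz_nat => bda.
have : (`|b| ^ 2 %| `|a| ^ 2)%N by rewrite -bda dvdn_mulr.
rewrite dvdn_pexp2r // => /dvdnP[m am].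
apply: (nsd m); apply/eqP.
by rewrite -(@eqn_pmul2l (`|b| ^ 2)) ?expn_gt0 ?absz_gt0 ?b0 // bda am expnMn mulnC.
Qed.

(** The state [(P, Q, Q')] stands for the surd [(P + sqrt d) / Q], where
    [Q * Q' = d - P ^ 2].  The third component is the preceding value of [Q];
    carrying it along makes the step of the expansion free of division. *)
Definition cf_step (a : int) (st : int * int * int) : int * int * int :=
  let: (P, Q, Q') := st in (a * Q - P, Q' + a * (P - (a * Q - P)), Q).

(** The last three inequalities say that [(P + sqrt d) / Q] is larger than 1
    and that its conjugate [(P - sqrt d) / Q] lies strictly between -1 and 0. *)
Definition reduced (R : realType) (d : nat) (st : int * int * int) : Prop :=
  let: (P, Q, Q') := st in let s := Num.sqrt (d%:R : R) in
  [/\ 0 < Q, Q * Q' = d%:Z - P ^+ 2, P%:~R < s, Q%:~R < P%:~R + s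
    & s - P%:~R < Q%:~R].

Definition quad (R : realType) (d : nat) (st : int * int * int) : R :=
  let: (P, Q, _) := st in (P%:~R + Num.sqrt (d%:R : R)) / Q%:~R.

Lemma quad_gt1 (R : realType) d st : reduced R d st -> 1 < quad R d st.
Proof.
case: st => [[P Q] Q'] [Q0 _ _ QPs _] /=.
by rewrite ltr_pdivlMr ?ltr0z // mul1r.
Qed.

(** With [P1 = a Q - P], the inverse of [(P + sqrt d) / Q - a] is
    [Q / (sqrt d - P1)], and it is rationalized by
    [Q1 Q = (sqrt d - P1) (sqrt d + P1)].  The same identity turns the bounds on
    [sqrt d - P1] and [sqrt d + P1] into those required of [Q1]. *)
Lemma reduced_step (R : realType) d st : nonsquare d -> reduced R d st ->
  let a := Num.floor (quad R d st) in
  reduced R d (cf_step a st) /\ (quad R d st - a%:~R)^-1 = quad R d (cf_step a st).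
Proof.
case: st => [[P Q] Q'] nsd red; have := quad_gt1 red.
case: red; set s := Num.sqrt _ => Q0 QQ Ps QPs sPQ.
set c := quad _ _ _ => c1 a.
have s2 : s ^+ 2 = (d%:Z)%:~R :> R by rewrite sqr_sqrtr.
have Q0R : 0 < Q%:~R :> R by rewrite ltr0z.
have cQ : Q%:~R * c = P%:~R + s by rewrite /c /= mulrC divfK // gt_eqF.
have /andP[ac ca] := floor_itv c.
rewrite -/a intrD in ac ca.
have a1 : 1 <= a%:~R :> R.
  by rewrite -[1]/(1%:~R) ler_int /a floor_ge_int ltW.
rewrite {}/cf_step.
set P1 := a * Q - P; set Q1 := Q' + a * (P - P1).
have P1R : P1%:~R = a%:~R * Q%:~R - P%:~R :> R by rewrite /P1 !(intrD, intrM, intrN).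
have QQ1 : Q1 * Q = d%:Z - P1 ^+ 2.
  have -> : (d%:Z = Q * Q' + P ^+ 2) by rewrite QQ subrK.
  by rewrite /Q1 /P1; ring.
have QQ1R : Q1%:~R * Q%:~R = s ^+ 2 - P1%:~R ^+ 2 :> R.
  by rewrite s2 -intrM QQ1 intrB rmorphXn.
have sP1 : P1%:~R < s.
  rewrite lt_neqAle; apply/andP; split; last by nra.
  apply/eqP => P1s; have := @sqrt_nonsquare_irrational R d P1 1 nsd.
  by rewrite mul1r -/s P1s => /(_ erefl).
have sP1' : s - P1%:~R < Q%:~R by nra.
have QsP1 : Q%:~R < P1%:~R + s by nra.
have Q10 : 0 < Q1%:~R :> R.
  rewrite -(pmulr_lgt0 _ Q0R) QQ1R; nra.
split.
  split => //; first by rewrite -(ltr0z R).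
  - rewrite -subr_gt0 -(pmulr_lgt0 _ Q0R).
    have -> : (P1%:~R + s - Q1%:~R) * Q%:~R
              = (s + P1%:~R) * (Q%:~R - (s - P1%:~R)) :> R.
      by rewrite mulrBl QQ1R; ring.
    by apply: mulr_gt0; lra.
  - rewrite -subr_gt0 -(pmulr_lgt0 _ Q0R).
    have -> : (Q1%:~R - (s - P1%:~R)) * Q%:~R
              = (s - P1%:~R) * (P1%:~R + s - Q%:~R) :> R.
      by rewrite mulrBl QQ1R; ring.
    by apply: mulr_gt0; lra.
have -> : c - a%:~R = (s - P1%:~R) / Q%:~R.
  by rewrite -[c](mulKf (lt0r_neq0 Q0R)) cQ P1R; field; rewrite lt0r_neq0.
rewrite invf_div /=; apply/eqP; rewrite -/s eqr_div ?lt0r_neq0 //; last by lra.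
by rewrite mulrC QQ1R; apply/eqP; ring.
Qed.

(** The expansion of a reduced surd can be run backwards: [Q] is part of the
    next state, and [P] is fixed modulo [Q] by that state while it lies in the
    interval of length [Q] ending at [sqrt d]. *)
Lemma reduced_step_inj (R : realType) d st1 st2 a1 a2 :
  reduced R d st1 -> reduced R d st2 -> cf_step a1 st1 = cf_step a2 st2 ->
  st1 = st2.
Proof.
case: st1 st2 => [[P Q] Q'] [[p q] q'] [Q0 QQ Ps QPs sPQ] [q0 qq ps qps spq].
rewrite /cf_step => -[eP _ eQ]; subst q.
have eP' : P - p = (a1 - a2) * Q by lia.
have : `|P - p| < Q by rewrite -(ltr_int R) intr_norm intrB ltr_norml; apply/andP; split; lra.
rewrite eP' normrM (gtr0_norm Q0) -[X in _ < X]mul1r ltr_pM2r // => a12.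
have {a12} a12 : a1 - a2 = 0 by lia.
have {eP' a12} eP' : P = p by move: eP'; rewrite a12; lia.
subst p; congr (_, _, _); apply: (mulfI (lt0r_neq0 Q0)); by rewrite QQ.
Qed.

(** Irrationality of [sqrt d] separates the rational and irrational parts of
    the two surds. *)
Lemma quad_inj (R : realType) d st1 st2 : nonsquare d ->
  reduced R d st1 -> reduced R d st2 -> quad R d st1 = quad R d st2 ->
  st1 = st2.
Proof.
case: st1 st2 => [[P Q] Q'] [[p q] q'] nsd [Q0 QQ _ _ _] [q0 qq _ _ _].
rewrite /quad; set s := Num.sqrt _ => /eqP.
rewrite eqr_div ?intr_eq0 ?lt0r_neq0 // => /eqP e.
have : (q - Q)%:~R * s = (p * Q - P * q)%:~R.
  by rewrite !intrB !intrM; lra.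
move=> /(sqrt_nonsquare_irrational nsd) qQ.
have {qQ} eQ : q = Q by lia.
subst q; have eP : P = p.
  have Q0R : Q%:~R != 0 :> R by rewrite intr_eq0 lt0r_neq0.
  by move/(mulIf Q0R): e => /addIr /intr_inj.
subst p; congr (_, _, _); apply: (mulfI (lt0r_neq0 Q0)); by rewrite QQ.
Qed.

Fixpoint cf_states (R : realType) (d : nat) (st : int * int * int) (k : nat) :=
  if k is k'.+1 then
    let st' := cf_states R d st k' in cf_step (Num.floor (quad R d st')) st'
  else st.

Lemma cf_states_add (R : realType) d st i k :
  cf_states R d st (i + k) = cf_states R d (cf_states R d st i) k.
Proof. by elim: k => [|k IH]; rewrite ?addn0 // addnS /= IH. Qed.

Lemma cf_statesP (R : realType) d st k : nonsquare d -> reduced R d st ->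
  reduced R d (cf_states R d st k) /\
  complete_quotient (quad R d st) k = quad R d (cf_states R d st k).
Proof.
move=> nsd red; elim: k => [//|k [redk ek]] /=.
by rewrite ek; have [? ?] := reduced_step nsd redk.
Qed.

(** Lagrange's theorem, by the pigeonhole principle: in a reduced state
    [0 < P < sqrt d] and [0 < Q < 2 sqrt d]. *)
Lemma cf_states_repeat (R : realType) d st : nonsquare d -> reduced R d st ->
  exists i l, (0 < l)%N /\ cf_states R d st (i + l) = cf_states R d st i.
Proof.
move=> nsd red; set s := Num.sqrt (d%:R : R).
(* A strict upper bound for P and Q is B.+1. *)
pose B := Num.truncn (2 * s).
have lt_B (z : int) : 0 <= z -> z%:~R < 2 * s -> (`|z| < B.+1)%N.
  move=> z0 zs; rewrite ltnS /B truncn_ge_nat; last first.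
    by apply: (le_trans _ (ltW zs)); rewrite ler0z.
  by rewrite -[_%:R]/((Posz _)%:~R) gez0_abs // ltW.
have bound k : let: (P, Q, _) := cf_states R d st k in
    [/\ 0 <= P, 0 < Q, (`|P| < B.+1)%N & (`|Q| < B.+1)%N].
  have [] := cf_statesP k nsd red; case: (cf_states _ _ _ _) => [[P Q] Q'].
  rewrite /reduced -/s => -[Q0 QQ Ps QPs sPQ] _.
  have Q0R : 0 < Q%:~R :> R by rewrite ltr0z.
  have P0 : 0 <= P by rewrite -(ler0z R); have := QPs; have := sPQ; lra.
  have P0R : 0 <= P%:~R :> R by rewrite ler0z.
  split=> //; apply: lt_B => //; [lra|exact: ltW|lra].
pose f (k : 'I_((B.+1 * B.+1).+1)) : 'I_B.+1 * 'I_B.+1 :=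
  let: (P, Q, _) := cf_states R d st k in (inord `|P|, inord `|Q|).
have /injectivePn[i [j nij eij]] : ~~ injectiveb f.
  apply/injectiveP => /leq_card.
  by rewrite card_prod !card_ord ltnn.
have {eij} eij : cf_states R d st i = cf_states R d st j.
  move: eij; rewrite /f; have := bound i; have := bound j.
  have [] := cf_statesP j nsd red; have [] := cf_statesP i nsd red.
  case: (cf_states _ _ _ _) => [[P Q] Q'] redi _.
  case: (cf_states _ _ _ _) => [[p q] q'] redj _.
  move=> [p0 q0 pB qB] [P0 Q0 PB QB] [/(congr1 val) eP /(congr1 val) eQ].
  rewrite /= !inordK // in eP eQ.
  have {eP PB pB} eP : P = p by lia.
  have {eQ QB qB} eQ : Q = q by lia.
  subst p q; congr (_, _, _); case: redi redj => [_ QQ _ _ _] [_ qq _ _ _].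
  by apply: (mulfI (lt0r_neq0 Q0)); rewrite QQ.
have {}nij : val i <> val j by move=> /val_inj ij; rewrite ij eqxx in nij.
wlog ij : i j eij nij / (i < j)%N => [H|].
  by case: (ltngtP i j) => // ij; [apply: (H i j)|apply: (H j i)] => //; apply: nesym.
by exists i, (j - i)%N; rewrite subn_gt0 ij subnKC // ltnW.
Qed.

(** If the partial quotients agree after a shift by [l], then the distance
    between the complete quotients of index [k] and [k + l] gets multiplied at
    each step by the product of two numbers larger than 1.  It also takes
    periodic values, so it vanishes.  Hence two states at distance [l] coincide,
    and running the expansion backwards brings this equality to index 0. *)
Lemma eventual_period_cf_states (R : realType) d st l :
  nonsquare d -> reduced R d st -> eventual_period (quad R d st) l ->
  cf_states R d st l = st.
Proof.
move=> nsd red [l0 [N perN]].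
pose f k := complete_quotient (quad R d st) k.
have fE k : f k = quad R d (cf_states R d st k) by have [] := cf_statesP k nsd red.
have f1 k : 1 < f k by rewrite fE; apply: quad_gt1; case: (cf_statesP k nsd red).
have [i [m [m0 im]]] := cf_states_repeat nsd red.
pose delta k := `|f (k + l)%N - f k|.
have delta_mono k : (N <= k)%N -> delta k <= delta k.+1 /\
    (0 < delta k -> delta k < delta k.+1).
  move=> Nk; have := perN k Nk; rewrite /partial_quotient -/(f k) -/(f (k + l)%N).
  move=> ea.
  have e1 : f k.+1 = (f k - (Num.floor (f k))%:~R)^-1 by [].
  have e2 : f (k.+1 + l)%N = (f (k + l)%N - (Num.floor (f k))%:~R)^-1.
    by rewrite -ea.
  have u1 := f1 k.+1; have u2 := f1 (k.+1 + l)%N.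
  have u : delta k.+1 = delta k * (f k.+1 * f (k.+1 + l)%N).
    rewrite /delta e1 e2 -[X in _ = _ * X]ger0_norm; last first.
      by rewrite -e1 -e2; apply: mulr_ge0; lra.
    rewrite -normrM distrC; congr (`|_|).
    field; apply/andP; split.
      by rewrite -invr_eq0 -e2 gt_eqF // (lt_trans ltr01).
    by rewrite -invr_eq0 -e1 gt_eqF // (lt_trans ltr01).
  have d0 : 0 <= delta k by apply: normr_ge0.
  have ff1 : 1 < f k.+1 * f (k.+1 + l)%N by nra.
  by rewrite u; split; nra.
have delta_ge k n : (N <= k)%N -> delta k <= delta (k + n)%N.
  move=> Nk; elim: n => [|n IH]; first by rewrite addn0.
  rewrite addnS; apply: (le_trans IH).
  by have [] := delta_mono (k + n)%N (leq_trans Nk (leq_addr _ _)).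
have per k : (i <= k)%N -> f (k + m)%N = f k.
  move=> ik; rewrite !fE -(subnKC ik) addnAC cf_states_add im -cf_states_add.
  by rewrite subnKC.
(* From index K on, both the shift by l and the repetition by m are in force. *)
pose K := maxn N i.
have NK : (N <= K)%N by apply: leq_maxl.
have iK : (i <= K)%N by apply: leq_maxr.
have dK : delta (K + m)%N = delta K.
  by rewrite /delta addnAC !per // (leq_trans iK) ?leq_addr.
have /eqP : delta K = 0.
  apply/eqP; case: eqVneq => // dn0.
  have dpos : 0 < delta K by rewrite lt_neqAle eq_sym dn0 normr_ge0.
  have [_ /(_ dpos)] := delta_mono K NK.
  have := delta_ge K.+1 m.-1 (leq_trans NK (leqnSn _)).
  by rewrite addSnnS prednK // dK => h /lt_le_trans /(_ h); rewrite ltxx.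
rewrite normr_eq0 subr_eq0 !fE => /eqP /quad_inj.
have redk k := (cf_statesP k nsd red).1.
move=> /(_ nsd (redk _) (redk _)).
elim: K {NK iK dK} => [|K IH]; first by rewrite add0n.
rewrite addSn /= => h; apply: IH.
exact: (reduced_step_inj (redk _) (redk _) h).
Qed.

Lemma complete_quotientS (R : realType) (alpha : R) k :
  complete_quotient alpha k.+1 =
  (complete_quotient alpha k - (Num.floor (complete_quotient alpha k))%:~R)^-1.
Proof. by []. Qed.

Lemma complete_quotient_addz (R : realType) (alpha : R) (m : int) k :
  complete_quotient (alpha + m%:~R) k.+1 = complete_quotient alpha k.+1.
Proof.
elim: k => [|k IH]; last first.
  by rewrite complete_quotientS IH -complete_quotientS.
rewrite !complete_quotientS /= floorDrz ?intr_int // intrKfloor intrD.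
by rewrite opprD addrACA subrr addr0.
Qed.

(** The expansions of [alpha] and [alpha + m] differ in their first partial
    quotient only. *)
Lemma eventual_period_addz (R : realType) (alpha : R) (m : int) l :
  eventual_period (alpha + m%:~R) l <-> eventual_period alpha l.
Proof.
have main (beta : R) n : eventual_period beta l -> eventual_period (beta + n%:~R) l.
  move=> [l0 [N perN]]; split=> //; exists N.+1 => -[//|k] Nk.
  by rewrite /partial_quotient addSn !complete_quotient_addz -addSn; apply/perN/ltnW.
split; last exact: main.
by move=> /(main _ (- m)); rewrite intrN addrK.
Qed.

Lemma periodP (R : realType) (alpha : R) l :
  eventual_period alpha l -> eventual_period alpha (period alpha).
Proof.
move=> pl; rewrite /period; case: xgetP => [x _ []//|none]; exfalso.
have ex : exists n, `[< eventual_period alpha n >] by exists l; apply/asboolP.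
case: (ex_minnP ex) => n /asboolP pn minn; apply: (none n); split=> // m pm.
by apply: minn; apply/asboolP.
Qed.

(** This transfers pure periodicity from a reduced surd to its integral
    translates such as [sqrt d] and [omega], for the very number that [period]
    picks. *)
Lemma period_cf_states (R : realType) d st (m : int) (alpha : R) :
  nonsquare d -> reduced R d st -> quad R d st = alpha + m%:~R ->
  (0 < period alpha)%N /\ cf_states R d st (period alpha) = st.
Proof.
move=> nsd red eqa.
have [i [l [l0 il]]] := cf_states_repeat nsd red.
have ev : eventual_period (quad R d st) l.
  split=> //; exists i => k ik; rewrite /partial_quotient.
  rewrite !(cf_statesP _ nsd red).2 -(subnKC ik) addnAC cf_states_add il.
  by rewrite -cf_states_add subnKC.
have ev' : eventual_period alpha (period alpha).
  by apply: periodP; apply/(eventual_period_addz _ m); rewrite -eqa; exact: ev.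
split; first by case: ev'.
by apply: eventual_period_cf_states => //; rewrite eqa eventual_period_addz.
Qed.

(** * Continuants, and a unit attached to the period *)

(** The pair of consecutive denominators of convergents
    [(q_(k-2), q_(k-1))], started at [(q_(-2), q_(-1)) = (1, 0)]. *)
Fixpoint continuants (R : realType) (d : nat) (st : int * int * int) (k : nat)
    : int * int :=
  if k is k'.+1 then
    let: (x, y) := continuants R d st k' in
    (y, Num.floor (quad R d (cf_states R d st k')) * y + x)
  else (1, 0).

Lemma continuantsS (R : realType) d st k :
  continuants R d st k.+1 =
  let: (x, y) := continuants R d st k in
  (y, Num.floor (quad R d (cf_states R d st k)) * y + x).
Proof. by []. Qed.

(** The left side is [Q] times the norm of [y c + x], where [c] is the surd
    of the state.  Each step of the expansion changes the sign of this quantity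
    and nothing else. *)
Lemma continuants_form (R : realType) d st k :
  let: (P, Q, Q') := cf_states R d st k in let: (x, y) := continuants R d st k in
  Q * x ^+ 2 + 2 * P * x * y - Q' * y ^+ 2 = (-1) ^+ k * st.1.2.
Proof.
elim: k => [|k] /=; first by case: st => [[P Q] Q'] /=; ring.
case: (cf_states _ _ _ _) => [[P Q] Q']; case: (continuants _ _ _ _) => x y.
move=> IH; rewrite [(-1) ^+ _]exprS -mulrA -IH /cf_step.
by set a := Num.floor _; ring.
Qed.

(** The recursion [y' = a y + x] reads [y / y' = 1 / (a + x / y)]; so the
    partial quotients show up in [s] in reverse order. *)
Lemma continuants_cf (R : realType) d st k : nonsquare d -> reduced R d st ->
  let: (x, y) := continuants R d st k.+1 in
  [/\ 0 <= x, x <= y, 0 < y & exists s : seq nat,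
    [/\ size s = k, all (fun a => 0 < a)%N s & x%:Q / y%:Q = cf0 s]].
Proof.
move=> nsd red; elim: k => [|k].
  rewrite /= mulr0 add0r; split=> //; exists [::]; split=> //.
rewrite [continuants _ _ _ k.+2]continuantsS.
have [redk _] := cf_statesP k.+1 nsd red.
case: (continuants _ _ _ k.+1) => x y [x0 xy y0 [s [sk s0 xys]]].
set a := Num.floor _.
have a1 : 1 <= a by rewrite floor_ge_int ltW // quad_gt1.
have ya : y <= a * y by rewrite ler_peMl // ltW.
split; [exact: ltW|lia|lia|].
exists (`|a|%N :: s); split=> /=; first by rewrite sk.
  by rewrite s0 andbT; lia.
rewrite -xys -[_%:R]/((Posz `|a|)%:Q) gez0_abs; last by lia.
have y0Q : y%:Q != 0 by rewrite intr_eq0; lia.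
have ayx : (a * y + x)%:Q != 0 by rewrite intr_eq0; lia.
rewrite -[LHS]invf_div; congr (_^-1).
by rewrite intrD intrM mulrDl mulfK.
Qed.

(** The case [i = 0] uses the state [(a0, 1, d - a0^2)], the case [i = 1] the
    state [(t, 2, (d - t^2) / 2)] with [t = 2 a0 - 1].  As the expansion returns
    to this state after one period, [continuants_form] gives the norm equation;
    it is multiplied by 4 or 2 to give both cases the same shape. *)
Lemma omega_period_unit (R : realType) (i : bool) d :
  nonsquare d -> (0 < d)%N -> (i -> d = 1 %[mod 4])%N ->
  exists a0 x y l : int, [/\ 0 < a0, 0 <= x, x <= y & 0 < y] /\
  [/\ l = periodD R i d, 0 < l,
    (if i then 1 else 4) * d%:Z * y ^+ 2
      = ((2 * a0 - i%:Z) * y + 2 * x) ^+ 2 - 4 * (-1) ^+ `|l| &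
    exists s : seq nat,
      [/\ size s = (`|l|).-1, all (fun a => 0 < a)%N s & x%:Q / y%:Q = cf0 s]].
Proof.
move=> nsd d0 id1.
have sirr := @sqrt_nonsquare_irrational R d _ 1 nsd.
set s := Num.sqrt (d%:R : R) in sirr.
have s_neq (a : int) : a%:~R != s.
  by apply/eqP => as_; have := sirr a; rewrite mul1r -as_ => /(_ erefl).
have s1 : 1 < s.
  rewrite lt_neqAle (s_neq 1) /= /s -[X in X <= _]sqrtr1 ler_sqrt ?ltr0n //.
  by rewrite -[1]/(1%:R) ler_nat.
have [a0 [m [st [a0pos red quadE forms]]]] :
  exists (a0 m : int) st, [/\ 0 < a0, reduced R d st,
    quad R d st = (if i then omega R d else s) + m%:~R &
    forall x y e : int, (let: (P, Q, Q') := st in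
      Q * x ^+ 2 + 2 * P * x * y - Q' * y ^+ 2 = e * st.1.2) ->
      (if i then 1 else 4) * d%:Z * y ^+ 2
      = ((2 * a0 - i%:Z) * y + 2 * x) ^+ 2 - 4 * e].
  case: i id1 => [/(_ isT) d1|_].
    have om : omega R d = (1 + s) / 2 by rewrite /omega d1.
    have /andP[] := floor_itv (omega R d); set a0 := Num.floor _.
    rewrite intrD om => fl1 fl2.
    have a0pos : 0 < a0 by rewrite floor_gt0 om; lra.
    have a0R : 1 <= a0%:~R :> R by rewrite -[1]/(1%:~R) ler_int.
    have [q dq] : exists q : int, d%:Z - (2 * a0 - 1) ^+ 2 = 2 * q.
      pose h := (d %/ 4)%N.
      have dh : d = (4 * h + 1)%N by rewrite [LHS](divn_eq d 4) d1 mulnC.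
      by exists (2 * h%:Z + 2 * a0 - 2 * a0 ^+ 2); rewrite dh; lia.
    (* The translate is theta = omega + (a0 - 1) = ((2 a0 - 1) + sqrt d) / 2. *)
    exists a0, (a0 - 1), (2 * a0 - 1, 2, q); split=> //.
    - rewrite /reduced -/s intrB intrM.
      have tn : 2 * a0%:~R - 1 != s by have := s_neq (2 * a0 - 1); rewrite intrB intrM.
      split=> //; [|lra|lra].
      by rewrite lt_neqAle tn; lra.
    - by rewrite /quad -/s !(intrB, intrM); field.
    - move=> x y e /= E.
      have -> : d%:Z = (2 * a0 - 1) ^+ 2 + 2 * q by rewrite -dq; lia.
      have -> : 4 * e = 2 * (e * 2) by lia.
      by rewrite -E /=; ring.
  have /andP[] := floor_itv s; set a0 := Num.floor _.
  rewrite intrD => fl1 fl2.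
  have a0pos : 0 < a0 by rewrite floor_gt0; lra.
  have a0R : 1 <= a0%:~R :> R by rewrite -[1]/(1%:~R) ler_int.
  exists a0, a0, (a0, 1, d%:Z - a0 ^+ 2); split=> //.
  - rewrite /reduced -/s; split=> //; [by rewrite mul1r| |lra|lra].
    by rewrite lt_neqAle s_neq.
  - by rewrite /quad divr1 addrC.
  - by move=> x y e /=; rewrite mulr1 => <-; rewrite subr0; ring.
have [l0 lst] := period_cf_states nsd red quadE.
have perE : period (if i then omega R d else s) = periodD R i d by rewrite /periodD; case: (i).
rewrite perE in l0 lst.
have := continuants_form R d st (periodD R i d); rewrite lst.
have := continuants_cf (periodD R i d).-1 nsd red; rewrite prednK //.
case: (continuants _ _ _ _) => x y [x0 xy y0 cfs] E.
exists a0, x, y, (periodD R i d)%:Z; split; split=> //.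
by apply: forms; case: (st) E => [[]].
Qed.

(** * Uniqueness of the length of a finite expansion *)

Lemma cf0_itv (s : seq nat) : all (fun a => 0 < a)%N s ->
  0 <= cf0 s <= 1 /\ (cf0 s = 0 -> s = [::]) /\ (cf0 s = 1 -> s = [:: 1%N]).
Proof.
elim: s => [|a s IH] //= /andP[a0 /IH [/andP[c0 c1] [e0 e1]]].
have a1 : 1 <= a%:R :> rat by rewrite ler1n.
have pos : 0 < a%:R + cf0 s by lra.
split; first by rewrite invr_ge0 ltW //= invf_le1 //; lra.
split=> /eqP.
  by rewrite invr_eq0 gt_eqF.
rewrite invr_eq1 => /eqP E; have c00 : cf0 s = 0 by lra.
have /eqP : a%:R = 1%:R :> rat by rewrite -[RHS]E c00 addr0.
by rewrite eqr_nat e0 // => /eqP ->.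
Qed.

(** The only ambiguity of finite expansions is
    [a_n = (a_n - 1) + 1 / 1], which changes the parity of the length. *)
Lemma cf0_size_inj (s t : seq nat) :
  all (fun a => 0 < a)%N s -> all (fun a => 0 < a)%N t ->
  odd (size s) = odd (size t) -> cf0 s = cf0 t -> size s = size t.
Proof.
elim: s t => [|a s IH] [|b t] //.
- by move=> _ t0 _ /esym; case: (cf0_itv t0) => _ [h _] /h.
- by move=> s0 _ _; case: (cf0_itv s0) => _ [h _] /h.
move=> /= /andP[a0 s0] /andP[b0 t0] /negb_inj par /invr_inj E; congr _.+1.
have [/andP[s0' s1] [sn sone]] := cf0_itv s0.
have [/andP[t0' t1] [tn tone]] := cf0_itv t0.
have [ab|ba|ab] := ltngtP a b.
- have : a.+1%:R <= b%:R :> rat by rewrite ler_nat.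
  rewrite -natr1 => ab'; have s1' : cf0 s = 1 by lra.
  have t0'' : cf0 t = 0 by lra.
  by move: par; rewrite sone // tn.
- have : b.+1%:R <= a%:R :> rat by rewrite ler_nat.
  rewrite -natr1 => ab'; have t1' : cf0 t = 1 by lra.
  have s0'' : cf0 s = 0 by lra.
  by move: par; rewrite tone // sn.
- by apply: IH => //; move: E; rewrite ab => /addrI.
Qed.

(** * The families of discriminants as norm equations *)

(** The norm of the unit: [x ^ 2] is congruent to it modulo [y]. *)
Definition norm_sign (par : bool) : int := if par then 1 else -1.

(** Common form of the four parametrizations: with [t = 2 a0 - i] and
    [D = 4 d] or [D = d], [D y^2 = (t y + 2 x)^2 - 4 e] for a sign [e]. *)
Definition norm_eq (i par : bool) (y x a0 : int) (d : nat) : Prop :=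
  (if i then 1 else 4) * d%:Z * y ^+ 2
  = ((2 * a0 - i%:Z) * y + 2 * x) ^+ 2 - 4 * norm_sign par.

Lemma rat_eq_divP (d : nat) (m y : int) : y != 0 ->
  (d%:R = m%:Q / y%:Q ^+ 2 :> rat) <-> (d%:Z * y ^+ 2 = m).
Proof.
move=> y0; have yQ : y%:Q ^+ 2 != 0 by rewrite expf_eq0 intr_eq0 (negbTE y0).
split=> [/(congr1 (fun r => r * y%:Q ^+ 2))|<-].
  rewrite divfK // => E; apply: (@intr_inj rat).
  by rewrite intrM rmorphXn -E.
by rewrite intrM rmorphXn mulfK.
Qed.

Lemma DcaseE (i par : bool) (y x : int) (d : nat) : 0 < y ->
  Dcase i par y x d <->
  [/\ (0 < d)%N, nonsquare d, (x ^+ 2 = norm_sign par %[mod y])%Z &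
    exists a0 : int, [/\ 0 < a0,
      (2 * a0 = i%:Z + x * ((1 - norm_sign par * x ^+ 2) %/ y)%Z %[mod y])%Z &
      norm_eq i par y x a0 d]].
Proof.
move=> y0; have yn0 : y != 0 by rewrite gt_eqF.
have yQ : y%:Q != 0 by rewrite intr_eq0.
have key (A B C : Prop) (P Q : int -> Prop) : (forall a, P a <-> Q a) ->
    [/\ A, B, C & exists a, P a] <-> [/\ A, B, C & exists a, Q a].
  by move=> PQ; split=> -[? ? ? [a /PQ ?]]; split=> //; exists a.
have key3 (A B C D : Prop) : (C <-> D) -> [/\ A, B & C] <-> [/\ A, B & D].
  by move=> CD; split=> -[? ? /CD ?]; split.
case: i par => -[]; rewrite /Dcase /D0m /D0p /D1m /D1p /norm_eq /norm_sign /=;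
  apply: key => a0;
  rewrite ?mulN1r ?opprK ?mul1r ?add0r; (apply: key3 || apply: key3).
- have -> : (2 * a0%:Q - 1) ^+ 2 + 4 * x%:Q / y%:Q * (2 * a0%:Q - 1)
           + (4 * x%:Q ^+ 2 - 4) / y%:Q ^+ 2
     = (((2 * a0 - 1) * y + 2 * x) ^+ 2 - 4)%:Q / y%:Q ^+ 2.
    by rewrite !(intrD, intrM, intrB, rmorphXn) /=; field.
  by rewrite rat_eq_divP // mulr1.
- have -> : (2 * a0%:Q - 1) ^+ 2 + 4 * x%:Q / y%:Q * (2 * a0%:Q - 1)
           + (4 * x%:Q ^+ 2 + 4) / y%:Q ^+ 2
     = (((2 * a0 - 1) * y + 2 * x) ^+ 2 + 4)%:Q / y%:Q ^+ 2.
    by rewrite !(intrD, intrM, intrB, rmorphXn) /=; field.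
  by rewrite rat_eq_divP // mulrN1 opprK.
- have -> : a0%:Q ^+ 2 + 2 * x%:Q / y%:Q * a0%:Q
           + (x%:Q ^+ 2 - 1) / y%:Q ^+ 2
     = ((a0 * y + x) ^+ 2 - 1)%:Q / y%:Q ^+ 2.
    by rewrite !(intrD, intrM, intrB, rmorphXn) /=; field.
  by rewrite rat_eq_divP //; split; lia.
- have -> : a0%:Q ^+ 2 + 2 * x%:Q / y%:Q * a0%:Q
           + (x%:Q ^+ 2 + 1) / y%:Q ^+ 2
     = ((a0 * y + x) ^+ 2 + 1)%:Q / y%:Q ^+ 2.
    by rewrite !(intrD, intrM, intrB, rmorphXn) /=; field.
  by rewrite rat_eq_divP //; split; lia.
Qed.

Lemma norm_signK par : norm_sign par * norm_sign par = 1.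
Proof. by case: par. Qed.

(** Put [t = 2 a0 - 1], [x^2 = k y + e] and [t = - e k x + m y].  Dividing the
    norm equation by [y^2] leaves [d = t^2 + 4 (m x - e k^2)], with [t] odd. *)
Lemma norm_eq_mod4 (par : bool) (y x a0 : int) (d : nat) : 0 < y ->
  (x ^+ 2 = norm_sign par %[mod y])%Z ->
  (2 * a0 = 1 + x * ((1 - norm_sign par * x ^+ 2) %/ y)%Z %[mod y])%Z ->
  norm_eq true par y x a0 d -> (d %% 4 = 1)%N.
Proof.
move=> y0 /eqP; rewrite eqz_mod_dvd => /dvdzP[k xk] /eqP.
rewrite /norm_eq [true%:Z]/(1 : int) mul1r.
have e2 := norm_signK par; move: (norm_sign par) xk e2 => e xk e2.
have -> : 1 - e * x ^+ 2 = (- e * k) * y.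
  by rewrite -mulrA -xk mulrBr !mulNr opprK e2; ring.
rewrite (mulzK _ (lt0r_neq0 y0)) eqz_mod_dvd => /dvdzP[m am].
set t := 2 * a0 - 1 => E.
have tE : t = x * (- e * k) + m * y by rewrite -am /t; ring.
have xE : x ^+ 2 = k * y + e by rewrite -xk subrK.
have tx : t * x + k = y * (m * x - e * k ^+ 2).
  transitivity (- e * k * x ^+ 2 + m * x * y + k); first by rewrite tE; ring.
  rewrite xE.
  transitivity (- e * k ^+ 2 * y - (e * e) * k + m * x * y + k); first by ring.
  by rewrite e2; ring.
suff : d%:Z = t ^+ 2 + 4 * (m * x - e * k ^+ 2) by rewrite /t; lia.
have yn0 : y ^+ 2 != 0 by rewrite expf_eq0 gt_eqF.
apply: (mulIf yn0); rewrite E.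
transitivity (t ^+ 2 * y ^+ 2 + 4 * (t * x * y + x ^+ 2 - e)); first by ring.
have -> : t * x * y + x ^+ 2 - e = y * (t * x + k) by rewrite xE; ring.
by rewrite tx; ring.
Qed.

Lemma norm_sign_mod_inj (par par' : bool) (y x : int) : 2 < y ->
  (x ^+ 2 = norm_sign par %[mod y])%Z -> (x ^+ 2 = norm_sign par' %[mod y])%Z ->
  par = par'.
Proof.
move=> y2 -> /eqP; rewrite eqz_mod_dvd.
by case: par par' => -[] //; rewrite dvdzE => /dvdn_leq; rewrite /norm_sign; lia.
Qed.

(** The two congruences that define the families are consequences of the norm
    equation.  It amounts to [x^2 - e = y k] with [k = n y - t x] for an integer
    [n], and [e^2 = 1] then gives [t = - e k x] modulo [y]. *)
Lemma norm_eq_congr (i par : bool) (y x a0 : int) (d : nat) :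
  0 < y -> (i -> d = 1 %[mod 4])%N -> norm_eq i par y x a0 d ->
  (x ^+ 2 = norm_sign par %[mod y])%Z /\
  (2 * a0 = i%:Z + x * ((1 - norm_sign par * x ^+ 2) %/ y)%Z %[mod y])%Z.
Proof.
move=> y0 d1; rewrite /norm_eq => E; set t := 2 * a0 - i%:Z in E.
have [n E'] : exists n : int, n * y ^+ 2 = t * x * y + x ^+ 2 - norm_sign par.
  case: i d1 @t E => [/(_ isT) d1|_] t E.
    have [n dn] : exists n : int, d%:Z = t ^+ 2 + 4 * n.
      have [h dh] : exists h, d = (4 * h + 1)%N.
        by exists (d %/ 4)%N; rewrite [LHS](divn_eq d 4) d1 mulnC.
      exists (h%:Z - a0 ^+ 2 + a0).
      by rewrite dh /t [true%:Z]/(1 : int) PoszD PoszM; ring.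
    exists n; apply: (@mulfI _ 4) => //.
    transitivity (1 * d%:Z * y ^+ 2 - t ^+ 2 * y ^+ 2); first by rewrite dn; ring.
    by rewrite E; ring.
  exists (d%:Z - a0 ^+ 2); apply: (@mulfI _ 4) => //.
  transitivity (4 * d%:Z * y ^+ 2 - 4 * a0 ^+ 2 * y ^+ 2); first by ring.
  by rewrite E /t [false%:Z]/(0 : int); ring.
have e2 := norm_signK par; move: (norm_sign par) E' e2 => e E' e2.
pose k := n * y - t * x.
have xk : x ^+ 2 - e = k * y by rewrite /k mulrBl -mulrA -expr2 E'; ring.
split; apply/eqP; rewrite eqz_mod_dvd; first by rewrite xk dvdz_mull.
have -> : 1 - e * x ^+ 2 = (- e * k) * y.
  by rewrite -mulrA -xk mulrBr !mulNr opprK e2; ring.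
rewrite (mulzK _ (lt0r_neq0 y0)).
have -> : 2 * a0 - (i%:Z + x * (- e * k)) = (e * x * n - t * e * k) * y.
  transitivity (t + e * x * k); first by rewrite /t; ring.
  transitivity (e * x * n * y + t * (e * e) - t * e * (x ^+ 2)).
    by rewrite e2 /k; ring.
  have -> : x ^+ 2 = k * y + e by rewrite -xk subrK.
  by ring.
exact: dvdz_mull.
Qed.

Lemma norm_eq_lt (i par : bool) (y x a0 a0' : int) (d d' : nat) :
  0 < y -> 0 <= x -> 0 < a0 -> 0 < a0' ->
  norm_eq i par y x a0 d -> norm_eq i par y x a0' d' -> (d' < d)%N -> a0' < a0.
Proof.
move=> y0 x0 a0p a0p' E E' dd; rewrite ltNge; apply/negP => aa.
have : (2 * a0 - i%:Z) * y + 2 * x <= (2 * a0' - i%:Z) * y + 2 * x.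
  by rewrite lerD2r ler_pM2r // lerD2r ler_pM2l.
have p0 : 0 <= (2 * a0 - i%:Z) * y + 2 * x.
  by rewrite addr_ge0 ?mulr_ge0 //; [case: (i); lia|lia].
move=> le; have : ((2 * a0 - i%:Z) * y + 2 * x) ^+ 2 <= ((2 * a0' - i%:Z) * y + 2 * x) ^+ 2.
  by rewrite ler_sqr ?nnegrE // (le_trans p0).
rewrite -(lerD2r (- (4 * norm_sign par))) -E -E' ler_pM2r ?exprn_gt0 //.
by rewrite ler_pM2l; case: (i) => //; lia.
Qed.

(** Two elements of the family have values of [2 a0] congruent modulo [y], so
    none can lie below [d] when [2 a0 < y].  The length [n] of the symmetric
    sequence has the parity of [size s] and represents the same fraction, so it
    equals [size s] and the period is exactly [n + 1]. *)
Lemma leasts_intro (R : realType) (i par : bool) (y x a0 : int) (d : nat)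
    (s : seq nat) :
  nonsquare d -> (0 < d)%N -> (i -> d = 1 %[mod 4])%N ->
  2 < y -> 0 <= x < y -> 0 < a0 -> 2 * a0 < y -> norm_eq i par y x a0 d ->
  all (fun a => 0 < a)%N s -> odd (size s) = par ->
  periodD R i d = (size s).+1 -> x%:Q / y%:Q = cf0 s ->
  leasts R i d.
Proof.
move=> nsd d0 d1 y2 /andP[x0 xy] a0p a0y E spos spar per xys.
have y0 : 0 < y by lia.
have [x2 a0c] := norm_eq_congr y0 d1 E.
have dD : Dcase i par y x d by apply/DcaseE => //; split=> //; exists a0.
have leD d' : Dset i y x d' -> (d <= d')%N.
  move=> D'; have {D'} [par' /(DcaseE _ _ _ _ y0)[_ _ x2' [b [b0 bc E']]]] :
    exists par', Dcase i par' y x d' by case: D'; [exists false|exists true].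
  have pp := norm_sign_mod_inj y2 x2' x2; subst par'.
  rewrite leqNgt; apply/negP => /(norm_eq_lt y0 x0 a0p b0 E E') ba.
  move: bc; rewrite -a0c => /eqP; rewrite eq_sym eqz_mod_dvd => /dvdzP[k ak].
  have kp : 0 < k by rewrite -(pmulr_lgt0 _ y0) -ak; lia.
  have yky : y <= k * y by rewrite ler_peMl // ltW.
  move: ak yky; move: (k * y) => ky; lia.
have Dd : Dset i y x d by case: (par) dD; [right|left].
exists y, x; split.
  split=> //.
  by move: x2; rewrite /norm_sign; case: (par); [left|right].
split; last by move=> d' [/leD].
split=> // -[_ [par' [n [/(DcaseE _ _ _ _ y0)[_ _ x2' _]]]]].
have pp := norm_sign_mod_inj y2 x2' x2; subst par'.
rewrite /symmetric_length ifF; last by apply/negbTE; lia.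
move=> [a [an apar apos _ xya]]; rewrite per -an.
have -> : size s = size a.
  by apply: cf0_size_inj => //; rewrite ?spar ?an // -xys -xya.
by rewrite addn1 ltnn.
Qed.

(** * A discriminant that is not a least has a small unit *)

Definition pell (T Y c d : nat) : Prop :=
  (T ^ 2 + c = d * Y ^ 2)%N \/ (T ^ 2 = d * Y ^ 2 + c)%N.

(** The bound 18 leaves room for the additive constants in what [y <= 2 a0]
    implies. *)
Definition small_pell (d : nat) : Prop := exists T Y c : nat,
  [/\ (0 < Y)%N, (Y ^ 2 <= 18 * d)%N, coprime T Y, (c \in [:: 1; 4])%N
    & pell T Y c d].

Lemma pell_coprime T Y c d : pell T Y c d -> coprime c Y -> coprime T Y.
Proof.
move=> pe cY; rewrite /coprime -dvdn1 -(eqP cY) dvdn_gcd dvdn_gcdr andbT.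
have gT : (gcdn T Y %| T ^ 2)%N by rewrite expnS dvdn_mulr ?dvdn_gcdl.
have gY : (gcdn T Y %| d * Y ^ 2)%N by rewrite expnS dvdn_mull ?dvdn_mulr ?dvdn_gcdr.
case: pe => E; first by rewrite -(dvdn_addr _ gT) E.
by rewrite -(dvdn_addr _ gY) -E.
Qed.

(** For [i = 0] the norm equation is divisible by 4.  For [i = 1] it is so
    when [y] is even, and otherwise [T] and [Y] have no common factor because
    [Y] is odd. *)
Lemma norm_eq_small_pell (i par : bool) (y x a0 : int) (d : nat) :
  0 < y -> 0 <= x -> 0 < a0 -> norm_eq i par y x a0 d ->
  y ^+ 2 <= 18 * d%:Z -> small_pell d.
Proof.
move=> y0 x0 a0p E yd.
have e1 : norm_sign par = 1 \/ norm_sign par = -1 by case: (par); [left|right].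
have intro (T Y : int) (c : nat) : 0 <= T -> 0 < Y -> Y <= y ->
    (c \in [:: 1; 4])%N -> coprime c `|Y| ->
    d%:Z * Y ^+ 2 = T ^+ 2 - c%:Z * norm_sign par -> small_pell d.
  move=> T0 Y0 Yy c14 cY E'; exists `|T|%N, `|Y|%N, c.
  have pe : pell `|T| `|Y| c d.
    have ET : T = `|T|%N by lia.
    have EY : Y = `|Y|%N by lia.
    rewrite ET EY in E'; move: (`|T|)%N (`|Y|)%N E' => t z.
    by case: e1 => -> E'; [right|left]; apply/eqP; rewrite -eqz_nat; lia.
  split=> //; [by rewrite absz_gt0 gt_eqF| |exact: pell_coprime pe cY].
  rewrite -lez_nat PoszM -abszX gez0_abs; last exact: exprn_ge0 (ltW Y0).
  have : Y ^+ 2 <= y ^+ 2 by rewrite ler_sqr ?nnegrE // ltW.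
  by move=> /le_trans; apply.
case: i E => E; last first.
  apply: (intro (a0 * y + x) y 1%N) => //.
  - by rewrite addr_ge0 ?mulr_ge0 // ltW.
  - exact: coprime1n.
  apply: (@mulfI _ 4) => //.
  transitivity (4 * d%:Z * y ^+ 2); first by ring.
  by rewrite E [false%:Z]/(0 : int); ring.
rewrite /norm_eq mul1r [true%:Z]/(1 : int) in E.
have T0 : 0 <= (2 * a0 - 1) * y + 2 * x by rewrite addr_ge0 ?mulr_ge0 //; lia.
case: (boolP (odd `|y|)) => oy.
  apply: (intro ((2 * a0 - 1) * y + 2 * x) y 4%N) => //.
  by rewrite -[4%N]/(2 ^ 2)%N coprimeXl // coprime2n.
have [z yz] : exists z, y = 2 * z by exists (`|y|./2)%:Z; lia.
apply: (intro ((2 * a0 - 1) * z + x) z 1%N) => //; [|lia|lia|exact: coprime1n|].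
  by rewrite addr_ge0 ?mulr_ge0 //; lia.
apply: (@mulfI _ 4) => //.
transitivity (d%:Z * y ^+ 2); first by rewrite yz; ring.
rewrite E yz; ring.
Qed.

Lemma leasts_or_small_pell (R : realType) (i : bool) d :
  nonsquare d -> (0 < d)%N -> (i -> d = 1 %[mod 4])%N ->
  leasts R i d \/ small_pell d.
Proof.
move=> nsd d0 d1.
have [a0 [x [y [l [[a0p x0 xy y0] [lper l0 E [s [ss spos xys]]]]]]]] :=
  omega_period_unit R nsd d0 d1.
(* The expansion of x / y has l - 1 terms, and the norm is (-1)^l. *)
pose par := ~~ odd `|l|%N.
have {}E : norm_eq i par y x a0 d.
  rewrite /norm_eq E; congr (_ - 4 * _); rewrite -signr_odd /par /norm_sign.
  by case: (odd _).
case: (boolP ((2 < y) && (2 * a0 < y))) => [/andP[y2 a0y]|small].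
  left; apply: (@leasts_intro R i par y x a0 d s) => //.
  - rewrite x0 lt_neqAle xy andbT; apply/eqP => exy.
    have [/eqP] := norm_eq_congr y0 d1 E.
    rewrite eqz_mod_dvd exy => /dvdzP[k ky] _.
    have {}ky : norm_sign par = (y - k) * y by rewrite mulrBl -ky; ring.
    have : (`|y| %| 1)%N.
      have -> : 1%N = `|norm_sign par|%N by rewrite /norm_sign; case: (par).
      by rewrite ky abszM dvdn_mull.
    by rewrite dvdn1; lia.
  - by rewrite ss /par -[in RHS](prednK (n := `|l|)) //; lia.
  - by rewrite ss prednK -?lper //; lia.
right; apply: (norm_eq_small_pell y0 x0 a0p E).
have d1' : 1 <= d%:Z by lia.
have [y2|a0y] : y <= 2 \/ y <= 2 * a0.
  by move: small; rewrite negb_and -!leNgt => /orP.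
  have : y ^+ 2 <= 2 ^+ 2 by rewrite ler_sqr ?nnegrE // ltW.
  lia.
pose t := 2 * a0 - i%:Z.
have t0 : 0 < t by rewrite /t; case: (i); lia.
have yt : y ^+ 2 <= (t + 1) ^+ 2.
  by rewrite ler_sqr ?nnegrE /t; case: (i); lia.
have y1 : 1 <= y ^+ 2 by rewrite exprn_ege1.
have tt : t ^+ 2 <= 4 * d%:Z + 4.
  rewrite -(ler_pM2r (exprn_gt0 2 y0)).
  have : t ^+ 2 * y ^+ 2 <= (t * y + 2 * x) ^+ 2.
    by rewrite -exprMn ler_sqr ?nnegrE ?lerDl; nia.
  have -> : (t * y + 2 * x) ^+ 2
      = (if i then 1 else 4) * d%:Z * y ^+ 2 + 4 * norm_sign par.
    by rewrite E /t subrK.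
  have : norm_sign par <= 1 by rewrite /norm_sign; case: (par).
  have : (if i then 1 else 4) * d%:Z * y ^+ 2 <= 4 * d%:Z * y ^+ 2.
    by case: (i) => //; rewrite ler_pM2r ?exprn_gt0 //; lia.
  rewrite mulrDl; lia.
nia.
Qed.

(** * Square roots modulo a square *)

(** Injection principle for a relation in place of a function: it spares the
    choice of a witness [b] for each [a]. *)
Lemma leq_size_rel (A : eqType) (B : choiceType) (s : seq A) (t : seq B)
    (r : A -> B -> Prop) :
  uniq s -> (forall a, a \in s -> exists2 b, b \in t & r a b) ->
  (forall a a' b, a \in s -> a' \in s -> r a b -> r a' b -> a = a') ->
  (size s <= size t)%N.
Proof.
move=> us ex inj; case: t ex => [|b0 t] ex.
  by case: s us inj ex => // a s _ _ /(_ a (mem_head _ _)) [b].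
pose f a := xget b0 [set b | b \in b0 :: t /\ r a b].
have fP a : a \in s -> f a \in b0 :: t /\ r a (f a).
  move=> /ex[b bt rab]; rewrite /f; case: xgetP => [c _ []//|/(_ b) []].
  by split.
rewrite -(size_map f); apply: uniq_leq_size.
  rewrite map_inj_in_uniq // => a a' sa sa' ff; apply: (inj a a' (f a)) => //.
    by case: (fP a sa).
  by rewrite ff; case: (fP a' sa').
by move=> _ /mapP[a /fP[fa _] ->].
Qed.

(** One of two complementary divisors of [n] is below [r]. *)
Lemma size_divisors_le (n r : nat) : (0 < n < r ^ 2)%N -> (size (divisors n) <= 2 * r)%N.
Proof.
move=> /andP[n0 nr].
have r0 : (0 < r)%N by case: (r) nr.
have -> : (2 * r = size [seq (b, k) | b <- [:: true; false], k <- iota 0 r])%N.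
  by rewrite size_allpairs size_iota.
pose f a := if (a < r)%N then (true, a) else (false, n %/ a)%N.
apply: (@leq_size_rel _ _ _ _ (fun a b => b = f a)).
- exact: divisors_uniq.
- move=> a an; exists (f a) => //; rewrite /f; case: ltnP => ar.
    by apply/allpairsP; exists (true, a); rewrite !inE mem_iota.
  apply/allpairsP; exists (false, n %/ a)%N; rewrite !inE mem_iota /= add0n.
  split=> //; rewrite ltn_divLR; last exact: leq_trans ar.
  by apply: (leq_trans nr); rewrite expnS expn1 leq_mul2l ar orbT.
- move=> a a' b; rewrite -!dvdn_divisors // => an an' ->; rewrite /f.
  case: ltnP => ar; case: ltnP => ar' // [] // e.
  have E1 := divnK an; have E2 := divnK an'; rewrite -e in E2.
  have q0 : (0 < n %/ a)%N by rewrite lt0n; apply: contraTneq n0 => q0; rewrite -E1 q0.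
  by apply/eqP; rewrite -(eqn_pmul2l q0) E1 E2.
Qed.

(** [Y^2 = g h] divides [(T + T0) (T - T0)], and [(T + T0) / g] is prime to
    [h], whence [h] divides [T - T0].  A common divisor of [g] and [h] divides
    [2 T0] and [Y^2], hence 2. *)
Lemma square_root_split (T T0 Y : nat) : (0 < Y)%N -> coprime T0 Y ->
  (T ^ 2 = T0 ^ 2 %[mod Y ^ 2])%N ->
  let g := gcdn (T + T0) (Y ^ 2) in let h := (Y ^ 2 %/ g)%N in
  (h %| `|T%:Z - T0%:Z|)%N /\ (gcdn g h %| 2)%N.
Proof.
move=> Y0 cT0 /eqP TT g h.
have Y20 : (0 < Y ^ 2)%N by rewrite expn_gt0 Y0.
have g0 : (0 < g)%N by rewrite gcdn_gt0 Y20 orbT.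
have gh : (g * h = Y ^ 2)%N by rewrite mulnC divnK ?dvdn_gcdr.
set D := `|_|%N.
have YD : (Y ^ 2 %| (T + T0) * D)%N.
  have : (Posz (T ^ 2) == Posz (T0 ^ 2) %[mod Posz (Y ^ 2)])%Z by rewrite !modz_nat eqz_nat.
  rewrite eqz_mod_dvd dvdzE absz_nat.
  suff -> : (T ^ 2)%N%:Z - (T0 ^ 2)%N%:Z = (T + T0)%N%:Z * (T%:Z - T0%:Z).
    by rewrite abszM.
  by rewrite !PoszD -!mulnn !PoszM; ring.
pose u := ((T + T0) %/ g)%N.
have uE : (T + T0 = g * u)%N by rewrite mulnC divnK ?dvdn_gcdl.
have cu : coprime h u.
  rewrite coprime_sym /coprime -(eqn_pmul2l g0) muln_gcdr -uE gh muln1.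
  exact: eqxx.
have hD : (h %| D)%N.
  by move: YD; rewrite uE -gh -mulnA dvdn_pmul2l // Gauss_dvdr.
split=> //; set c := gcdn g h.
have cs : (c %| T + T0)%N by rewrite uE dvdn_mulr ?dvdn_gcdl.
have cD : (c %| D)%N by apply: dvdn_trans hD; rewrite dvdn_gcdr.
have c2 : (c %| T0 * 2)%N.
  have : (Posz c %| (T + T0)%N%:Z - (T%:Z - T0%:Z))%Z.
    by apply: rpredB; rewrite dvdzE.
  suff -> : (T + T0)%N%:Z - (T%:Z - T0%:Z) = (T0 * 2)%N by rewrite dvdzE.
  by lia.
rewrite -(@Gauss_dvdr c T0) //.
have cY : (c %| Y ^ 2)%N by rewrite -gh dvdn_mulr ?dvdn_gcdl.
by apply: coprime_dvdl cY _; rewrite coprimeXl // coprime_sym.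
Qed.

Lemma gcdn_sqr (a b : nat) : (gcdn (a ^ 2) (b ^ 2) = gcdn a b ^ 2)%N.
Proof.
case: (posnP a) => [->|a0]; first by rewrite exp0n // !gcd0n.
pose g := gcdn a b; have g0 : (0 < g)%N by rewrite gcdn_gt0 a0.
have aE : (a = g * (a %/ g))%N by rewrite mulnC divnK ?dvdn_gcdl.
have bE : (b = g * (b %/ g))%N by rewrite mulnC divnK ?dvdn_gcdr.
rewrite -/g {1}aE {1}bE !expnMn -muln_gcdr.
suff /eqP -> : coprime ((a %/ g) ^ 2) ((b %/ g) ^ 2) by rewrite muln1.
rewrite coprimeXl // coprimeXr //.
by rewrite /coprime -(eqn_pmul2l g0) muln_gcdr -aE -bE muln1.
Qed.

Lemma divn_inj_dvd (m a b : nat) : (a %/ m = b %/ m)%N ->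
  (m %| `|a%:Z - b%:Z|)%N -> a = b.
Proof.
move=> q mab; have : (Posz m %| a%:Z - b%:Z)%Z by rewrite dvdzE.
rewrite -eqz_mod_dvd !modz_nat eqz_nat => /eqP mo.
by rewrite (divn_eq a m) (divn_eq b m) q mo.
Qed.

(** Fix one root [T0].  With [g] and [h] as in [square_root_split], [T] is
    known modulo [g] and modulo [h], so that [2 T] is known modulo [Y^2]; its
    quotient by [Y^2] then determines it.  The divisor [g] of [Y^2] is in turn
    determined by a divisor of [Y], since
    [gcd (g, Y)^2 = gcd (g^2, g h) = g gcd (g, h)] where [gcd (g, h)] is 1 or 2.
    This is what gives [tau(Y)] in place of [tau(Y^2)]. *)
Lemma count_square_roots (P : pred nat) (Y H : nat) : (0 < Y)%N ->
  (forall T, P T -> coprime T Y) ->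
  (forall T T', P T -> P T' -> T ^ 2 = T' ^ 2 %[mod Y ^ 2])%N ->
  (count P (iota 0 H) <= size (divisors Y) * 2 * ((2 * H) %/ Y ^ 2).+1)%N.
Proof.
move=> Y0 cP sP; case: (boolP (has P (iota 0 H))) => [/hasP[T0 _ P0]|]; last first.
  by rewrite has_count -leqNgt leqn0 => /eqP ->.
have Y20 : (0 < Y ^ 2)%N by rewrite expn_gt0 Y0.
pose g T := gcdn (T + T0) (Y ^ 2); pose h T := (Y ^ 2 %/ g T)%N.
pose c T := gcdn (g T) (h T); pose a T := gcdn (g T) Y.
have gh T : (g T * h T = Y ^ 2)%N by rewrite mulnC divnK ?dvdn_gcdr.
have g0 T : (0 < g T)%N by rewrite gcdn_gt0 Y20 orbT.
have c0 T : (0 < c T)%N by rewrite gcdn_gt0 g0.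
have aE T : (g T = a T ^ 2 %/ c T)%N.
  by rewrite -gcdn_sqr -(gh T) -mulnn -muln_gcdr mulnK ?c0.
pose t := [seq (z, q) | z <- [seq (u, v) | u <- divisors Y, v <- [:: 1%N; 2%N]],
                        q <- iota 0 ((2 * H) %/ Y ^ 2).+1].
have -> : (size (divisors Y) * 2 * ((2 * H) %/ Y ^ 2).+1 = size t)%N.
  by rewrite !size_allpairs size_iota.
rewrite -size_filter.
apply: (@leq_size_rel _ _ _ _
  (fun T b => b = (a T, c T, (2 * T) %/ Y ^ 2)%N)).
- exact: filter_uniq (iota_uniq _ _).
- move=> T; rewrite mem_filter mem_iota add0n => /andP[PT TH].
  exists (a T, c T, (2 * T) %/ Y ^ 2)%N => //.
  apply/allpairsP; exists (a T, c T, (2 * T) %/ Y ^ 2)%N; split=> //.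
    apply/allpairsP; exists (a T, c T); split=> //.
      by rewrite -dvdn_divisors // dvdn_gcdr.
    have [_] := square_root_split Y0 (cP _ P0) (sP _ _ PT P0).
    rewrite -/(g T) -/(h T) -/(c T) => /dvdn_leq; have := c0 T.
    by case: (c T) => [|[|[|?]]] //= _ /(_ isT).
  by rewrite mem_iota add0n /= ltnS leq_div2r // leq_mul2l (ltnW TH) orbT.
- move=> T T' b; rewrite !mem_filter => /andP[PT _] /andP[PT' _] -> [ea ec eq].
  have eg : g T = g T' by rewrite !aE ea ec.
  have [hT c2] := square_root_split Y0 (cP _ P0) (sP _ _ PT P0).
  have [hT' _] := square_root_split Y0 (cP _ P0) (sP _ _ PT' P0).
  rewrite -/(g T) -/(h T) in hT c2; rewrite -/(g T') -/(h T') in hT'.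
  have eh : h T = h T' by rewrite /h eg.
  have gTT : (g T %| `|T%:Z - T'%:Z|)%N.
    have : (Posz (g T) %| (T + T0)%N%:Z - (T' + T0)%N%:Z)%Z.
      by apply: rpredB; rewrite dvdzE; [|rewrite eg]; exact: dvdn_gcdl.
    suff -> : (T + T0)%N%:Z - (T' + T0)%N%:Z = T%:Z - T'%:Z by rewrite dvdzE.
    by lia.
  have hTT : (h T %| `|T%:Z - T'%:Z|)%N.
    have : (Posz (h T) %| (T%:Z - T0%:Z) - (T'%:Z - T0%:Z))%Z.
      by apply: rpredB; rewrite dvdzE //= eh.
    by rewrite dvdzE opprB addrA subrK.
  have : (Y ^ 2 %| `|(2 * T)%N%:Z - (2 * T')%N%:Z|)%N.
    rewrite !PoszM -mulrBr abszM -(gh T) -muln_lcm_gcd mulnC.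
    by apply: dvdn_mul => //; rewrite dvdn_lcm gTT hTT.
  move=> /(divn_inj_dvd eq) TT'; apply/eqP.
  by rewrite -(@eqn_pmul2l 2) // TT'.
Qed.

(** * Counting discriminants with a small unit *)

(** The boolean of [k] tells whether [k.2] is added to [T ^ 2] or to
    [d * Y ^ 2] in the equation [pell]. *)
Definition pell_congr (k : bool * nat) (Y T : nat) : bool :=
  coprime T Y && (if k.1 then (Y ^ 2 %| T ^ 2 + k.2)%N
                  else (T ^ 2 == k.2 %[mod Y ^ 2])%N).

Definition pell_kinds : seq (bool * nat) :=
  [seq (b, c) | b <- [:: true; false], c <- [:: 1%N; 4%N]].

Lemma count_pell_congr k (Y H : nat) : (0 < Y)%N ->
  (count (pell_congr k Y) (iota 0 H)
    <= size (divisors Y) * 2 * ((2 * H) %/ Y ^ 2).+1)%N.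
Proof.
move=> Y0; apply: count_square_roots => // [T /andP[]//|T T' /andP[_ e] /andP[_ e']].
case: k e e' => -[] c /= e e'; last by rewrite (eqP e) (eqP e').
apply/eqP; rewrite -(eqn_modDr c); move: e e'; rewrite /dvdn => /eqP -> /eqP ->.
exact: eqxx.
Qed.

(** The triple formed by [Y], [T] and the constant of the equation
    determines [d], while [Y <= 5 s] and [T < s Y + 3]. *)
Lemma count_small_pell_le_sum (N s : nat) : (N <= s ^ 2)%N ->
  (count (fun d => `[< small_pell d >]) (iota 0 N.+1)
   <= \sum_(1 <= Y < (5 * s).+1) \sum_(k <- pell_kinds)
        count (pell_congr k Y) (iota 0 (s * Y + 3)))%N.
Proof.
move=> Ns.
pose t := [seq (z, T) |
  z <- [seq (Y, k) | Y <- index_iota 1 (5 * s).+1, k <- pell_kinds],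
  T <- seq.filter (pell_congr z.2 z.1) (iota 0 (s * z.1 + 3))].
have -> : (\sum_(1 <= Y < (5 * s).+1) \sum_(k <- pell_kinds)
        count (pell_congr k Y) (iota 0 (s * Y + 3)) = size t)%N.
  rewrite size_allpairs_dep sumnE big_map big_allpairs_dep /=.
  by apply: eq_bigr => Y _; apply: eq_bigr => k _; rewrite size_filter.
rewrite -size_filter; apply: (@leq_size_rel _ _ _ _
  (fun d (b : nat * (bool * nat) * nat) => let: (Y, k, T) := b in
    (0 < Y)%N /\ (if k.1 then T ^ 2 + k.2 = d * Y ^ 2
                  else T ^ 2 = d * Y ^ 2 + k.2)%N)).
- exact: filter_uniq (iota_uniq _ _).
- move=> d; rewrite mem_filter mem_iota ltnS => /andP[/asboolP].
  move=> [T [Y [c [Y0 Yd cTY c14 pe]]]] /andP[_ dN].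
  have ds : (d <= s ^ 2)%N by apply: leq_trans Ns.
  have Ys : (Y <= 5 * s)%N.
    rewrite -leq_sqr (leq_trans Yd) // expnMn.
    by apply: leq_mul.
  have TsY : (T < s * Y + 3)%N.
    rewrite -ltn_sqr; apply: (@leq_ltn_trans (d * Y ^ 2 + 4)).
      move: c14; rewrite !inE => /orP c14.
      by case: c14 pe => /eqP -> [|]; lia.
    apply: (@leq_ltn_trans ((s * Y) ^ 2 + 4)).
      by rewrite leq_add2r expnMn leq_mul2r ds orbT.
    by move: (s * Y)%N => m; nia.
  pose b := ~~ `[< (T ^ 2 = d * Y ^ 2 + c)%N >].
  have E : if b then (T ^ 2 + c = d * Y ^ 2)%N else (T ^ 2 = d * Y ^ 2 + c)%N.
    by rewrite /b; case: asboolP => [//|] /=; case: pe.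
  exists (Y, (b, c), T) => //.
  apply/allpairsPdep; exists (Y, (b, c)), T; split=> //.
    apply/allpairsP; exists (Y, (b, c)); split=> //.
      by rewrite mem_index_iota Y0 ltnS.
    apply/allpairsP; exists (b, c); split=> //.
    by case: (b).
  rewrite mem_filter mem_iota add0n TsY andbT /= /pell_congr cTY /=.
  case: (b) E => -> ; first by rewrite dvdn_mull.
  by rewrite modnMDl eqxx.
- move=> d d' [[Y k] T] _ _ [Y0 E] [_ E'].
  have Y20 : (0 < Y ^ 2)%N by rewrite expn_gt0 Y0.
  apply/eqP; rewrite -(eqn_pmul2r Y20); apply/eqP.
  case: k.1 E E' => [<- <- //|-> /eqP]; by rewrite eqn_add2r => /eqP.
Qed.

(** By induction, as [1 / sqrt (n + 1)] is at most
    [2 (sqrt (n + 1) - sqrt n)]. *)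
Lemma sum_invsqrt_le (R : realType) (n : nat) :
  \sum_(1 <= k < n.+1) (Num.sqrt (k%:R : R))^-1 <= 2 * Num.sqrt n%:R.
Proof.
elim: n => [|n IH]; first by rewrite big_geq // sqrtr0 mulr0.
rewrite big_nat_recr //=; apply: (le_trans (lerD IH (lexx _))).
set u := Num.sqrt n%:R; set v := Num.sqrt n.+1%:R.
have u2 : u ^+ 2 = n%:R by rewrite sqr_sqrtr.
have v2 : v ^+ 2 = u ^+ 2 + 1 by rewrite sqr_sqrtr // u2 natr1.
have u0 : 0 <= u by apply: sqrtr_ge0.
have v0 : 0 < v by rewrite sqrtr_gt0 ltr0n.
rewrite -(ler_pM2r v0) mulrDl mulVf ?gt_eqF //.
have := sqr_ge0 (u - v); nra.
Qed.

(** With [s] of the order of [sqrt N], this is a bound [O(N^(3/4))]. *)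
Lemma count_small_pell_le (R : realType) :
  exists2 C : R, 0 < C & forall N s : nat, (N <= s ^ 2)%N ->
    (count (fun d => `[< small_pell d >]) (iota 0 N.+1))%:R
    <= C * s%:R * Num.sqrt s%:R.
Proof.
(* For each Y: 4 equations, times 4 sqrt Y divisors, times 2, times 13 s / Y, which is
   416 s / sqrt Y; the sum over Y <= 5 s is at most 832 s sqrt (5 s),
   and sqrt 5 <= 3. *)
exists 2496; first by rewrite ltr0n.
move=> N s Ns; case: (posnP s) => [s0|s0].
  move: (count_small_pell_le_sum Ns); rewrite s0 muln0 big_geq // leqn0 => /eqP ->.
  by rewrite mulr0 mul0r.
have term Y : (1 <= Y < (5 * s).+1)%N ->
    (\sum_(k <- pell_kinds) count (pell_congr k Y) (iota 0 (s * Y + 3)))%:R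
    <= 416 * s%:R * (Num.sqrt (Y%:R : R))^-1.
  rewrite ltnS => /andP[Y0 Ys].
  set u := Num.sqrt Y%:R.
  have u2 : u ^+ 2 = Y%:R by rewrite sqr_sqrtr.
  have u1 : 1 <= u by rewrite /u -[X in X <= _]sqrtr1 ler_sqrt // ler1n.
  pose r := (Num.truncn u).+1.
  have /andP[tu ut] := truncn_itv (le_trans ler01 u1).
  have Dr : (size (divisors Y) <= 2 * r)%N.
    apply: size_divisors_le; rewrite Y0 /= -(ltr_nat R) -u2 natrX.
    by rewrite ltr_sqr ?nnegrE ?ler0n //; lra.
  pose q := ((2 * (s * Y + 3)) %/ Y ^ 2)%N.
  (* q Y^2 <= 2 s Y + 6 and Y <= 5 s give (q + 1) Y <= 2 s + 6 + 5 s <= 13 s. *)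
  have qY : (q.+1 * Y <= 13 * s)%N.
    have q1 : (q * Y ^ 2 <= 2 * (s * Y + 3))%N by apply: leq_trunc_div.
    rewrite mulSn -(leq_pmul2r Y0).
    nia.
  have cle : (\sum_(k <- pell_kinds) count (pell_congr k Y) (iota 0 (s * Y + 3))
      <= 4 * (2 * r * 2 * q.+1))%N.
    apply: (@leq_trans (\sum_(k <- pell_kinds) (2 * r * 2 * q.+1))%N).
      apply: leq_sum => k _; apply: (leq_trans (count_pell_congr _ _ Y0)).
      by rewrite leq_mul2r leq_mul2r Dr !orbT.
    by rewrite big_const_seq iter_addn_0 mulnC.
  have u0 : 0 < u by lra.
  rewrite ler_pdivlMr //.
  apply: (@le_trans _ _ ((4 * (2 * r * 2 * q.+1))%N%:R * u)).
    by rewrite ler_pM2r // ler_nat.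
  have r2u : r%:R <= 2 * u :> R by rewrite /r -natr1; lra.
  have qYR : q.+1%:R * u ^+ 2 <= 13 * s%:R :> R.
    by rewrite u2 -!natrM ler_nat.
  rewrite !natrM.
  have q0 : 0 <= q.+1%:R :> R by apply: ler0n.
  have : r%:R * q.+1%:R * u <= 2 * (q.+1%:R * u ^+ 2).
    have -> : 2 * (q.+1%:R * u ^+ 2) = 2 * u * q.+1%:R * u by ring.
    by rewrite ler_pM2r // ler_wpM2r.
  lra.
apply: (@le_trans _ _ (\sum_(1 <= Y < (5 * s).+1)
    416 * s%:R * (Num.sqrt (Y%:R : R))^-1)).
  apply: (@le_trans _ _ (\sum_(1 <= Y < (5 * s).+1) \sum_(k <- pell_kinds)
        count (pell_congr k Y) (iota 0 (s * Y + 3)))%N%:R).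
    by rewrite ler_nat; apply: count_small_pell_le_sum.
  by rewrite natr_sum ler_sum_nat.
rewrite -mulr_sumr.
apply: (le_trans (ler_wpM2l _ (sum_invsqrt_le R (5 * s)))).
  by apply: mulr_ge0; rewrite ler0n.
rewrite natrM sqrtrM ?ler0n //.
set v := Num.sqrt s%:R; set w := Num.sqrt 5%:R.
have w3 : w <= 3.
  have -> : 3 = Num.sqrt (3 ^+ 2) :> R by rewrite sqrtr_sqr ger0_norm.
  by rewrite ler_sqrt // -natrX ler_nat.
have v0 : 0 <= v by apply: sqrtr_ge0.
have sv0 : 0 <= s%:R * v by rewrite mulr_ge0.
have : s%:R * v * w <= s%:R * v * 3 by rewrite ler_wpM2l.
lra.
Qed.

(** * Squarefree integers congruent to 1 modulo 4 *)

Lemma count_residue_class (P : pred nat) (m H : nat) :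
  (forall T T', P T -> P T' -> m %| `|T%:Z - T'%:Z|)%N ->
  (count P (iota 0 H) <= (H %/ m).+1)%N.
Proof.
move=> Pm; rewrite -size_filter -[X in (_ <= X)%N](size_iota 0).
apply: (@leq_size_rel _ _ _ _ (fun T q => q = T %/ m)%N).
- exact: filter_uniq (iota_uniq _ _).
- move=> T; rewrite mem_filter mem_iota add0n => /andP[_ TH].
  by exists (T %/ m)%N => //; rewrite mem_iota add0n ltnS leq_div2r // ltnW.
- move=> T T' q; rewrite !mem_filter => /andP[PT _] /andP[PT' _] -> e.
  by apply: divn_inj_dvd e _; apply: Pm.
Qed.

Lemma squarefree_pos d : squarefree d -> (0 < d)%N.
Proof. by case: d => // /(_ 2%N (dvdn0 _)). Qed.

Lemma squarefree_mod4 d : squarefree d ->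
  [\/ (d %% 4 = 1)%N, (d %% 4 = 2)%N | (d %% 4 = 3)%N].
Proof.
move=> sf; have : (d %% 4 < 4)%N by rewrite ltn_mod.
case E : (d %% 4)%N => [|[|[|[|]]]] // _; [|by constructor..].
have := sf 2%N; rewrite /dvdn E eqxx => /(_ isT); lia.
Qed.

Lemma squarefree_nonsquare d : (1 < d)%N -> squarefree d -> nonsquare d.
Proof.
move=> d1 sf m dm; have := sf m; rewrite dm dvdnn in d1 * => /(_ isT) m1.
by rewrite m1 in d1.
Qed.

Lemma not_squarefree_odd (d s : nat) : odd d -> (d <= s ^ 2)%N -> ~ squarefree d ->
  exists2 k, (1 <= k < s.+1)%N & ((2 * k + 1) ^ 2 %| d)%N.
Proof.
move=> od ds /existsNP[m] /not_implyP[md m1].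
have d0 : (0 < d)%N by case: (d) od.
have om : odd m.
  have := dvdn_odd md od; by rewrite oddX.
have ms : (m <= s)%N by rewrite -leq_sqr; apply: leq_trans ds; exact: dvdn_leq.
exists m./2; first by lia.
by have -> : (2 * m./2 + 1 = m)%N by lia.
Qed.

(** Telescoping: [1 / (2 k + 1)^2] is at most [1 / (4 k) - 1 / (4 (k + 1))]. *)
Lemma sum_odd_square_le (R : realType) (n : nat) :
  \sum_(1 <= k < n.+1) ((2 * k + 1)%N%:R ^+ 2 : R)^-1 <= 1 / 4.
Proof.
suff : \sum_(1 <= k < n.+1) ((2 * k + 1)%N%:R ^+ 2 : R)^-1
    <= 1 / 4 - 1 / (4 * n.+1%:R).
  move/le_trans; apply; rewrite gerBl divr_ge0 ?mulr_ge0 //.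
elim: n => [|n IH]; first by rewrite big_geq // mulr1 subrr.
rewrite big_nat_recr //=; apply: (le_trans (lerD IH (lexx _))).
have n0 : 0 <= n%:R :> R by apply: ler0n.
rewrite natrD natrM -[n.+2%:R]natr1 -[n.+1%:R]natr1; set x : R := n%:R in n0 *.
rewrite -subr_ge0.
have -> : 1 / 4 - 1 / (4 * (x + 1 + 1))
    - (1 / 4 - 1 / (4 * (x + 1)) + ((2 * (x + 1) + 1) ^+ 2)^-1)
  = 1 / (4 * (x + 1) * (x + 2) * (2 * (x + 1) + 1) ^+ 2).
  by field; do ?(apply/andP; split); rewrite gt_eqF //; lra.
by rewrite divr_ge0 // !mulr_ge0 ?sqr_ge0 //; lra.
Qed.

Definition sqfree_1mod4 (d : nat) : bool := `[< squarefree d /\ (d = 1 %[mod 4])%N >].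

(** Among the [J] integers [4 j + 1] up to [N], at most [J / m^2 + 1] are
    multiples of the odd square [m^2], and [3 <= m <= s].  By
    [sum_odd_square_le], this removes at most [J / 4 + s] of them. *)
Lemma count_sqfree_1mod4_ge (R : realType) (N s : nat) : (0 < N)%N -> (N <= s ^ 2)%N ->
  3 / 16 * N%:R - s%:R <= (count sqfree_1mod4 (iota 0 N.+1))%:R :> R.
Proof.
move=> N0 Ns; pose J := ((N + 3) %/ 4)%N.
have NJ : (N <= 4 * J)%N by rewrite /J; lia.
have JN j : (j < J)%N -> (4 * j + 1 <= N)%N by rewrite /J; lia.
pose P j := `[< squarefree (4 * j + 1) >].
have c1 : (count P (iota 0 J) <= count sqfree_1mod4 (iota 0 N.+1))%N.
  rewrite -!size_filter.
  apply: (@leq_size_rel _ _ _ _ (fun j d => d = 4 * j + 1)%N).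
  - exact: filter_uniq (iota_uniq _ _).
  - move=> j; rewrite mem_filter mem_iota add0n => /andP[/asboolP sf /JN jN].
    exists (4 * j + 1)%N => //; rewrite mem_filter mem_iota add0n /= ltnS jN andbT.
    by apply/asboolP; split=> //; rewrite mulnC modnMDl.
  - by move=> j j' d _ _ ->; lia.
pose B k j := ((2 * k + 1) ^ 2 %| 4 * j + 1)%N.
have c2 : (count (predC P) (iota 0 J)
    <= \sum_(1 <= k < s.+1) count (B k) (iota 0 J))%N.
  pose t := [seq (k, j) | k <- index_iota 1 s.+1, j <- seq.filter (B k) (iota 0 J)].
  have -> : (\sum_(1 <= k < s.+1) count (B k) (iota 0 J) = size t)%N.
    rewrite size_allpairs_dep sumnE big_map /=.
    by apply: eq_bigr => k _; rewrite size_filter.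
  rewrite -size_filter; apply: (@leq_size_rel _ _ _ _ (fun j b => b.2 = j)).
  - exact: filter_uniq (iota_uniq _ _).
  - move=> j; rewrite mem_filter mem_iota add0n => /andP[/asboolPn nsf jJ].
    have oj : odd (4 * j + 1) by lia.
    have [k ks kd] := not_squarefree_odd oj (leq_trans (JN _ jJ) Ns) nsf.
    exists (k, j) => //; apply/allpairsPdep; exists k, j; split=> //.
      by rewrite mem_index_iota.
    by rewrite mem_filter mem_iota add0n /B kd.
  - by move=> j j' b _ _ <- <-.
have c3 : (count (predC P) (iota 0 J))%:R <= 1 / 4 * J%:R + s%:R :> R.
  apply: (@le_trans _ _ (\sum_(1 <= k < s.+1)
      (J%:R * ((2 * k + 1)%N%:R ^+ 2)^-1 + 1) : R)); last first.
    rewrite big_split /= -mulr_sumr sumr_const_nat subn1 /= lerD2r.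
    by rewrite mulrC ler_wpM2r // sum_odd_square_le.
  apply: (le_trans (y := (\sum_(1 <= k < s.+1) count (B k) (iota 0 J))%N%:R)).
    by rewrite ler_nat.
  rewrite natr_sum; apply: ler_sum => k _.
  apply: (le_trans (y := (J %/ (2 * k + 1) ^ 2).+1%:R)).
    rewrite ler_nat; apply: count_residue_class => j j'; rewrite /B => Bj Bj'.
    have : (Posz ((2 * k + 1) ^ 2) %| (4 * j + 1)%N%:Z - (4 * j' + 1)%N%:Z)%Z.
      by apply: rpredB; rewrite dvdzE.
    have -> : (4 * j + 1)%N%:Z - (4 * j' + 1)%N%:Z = 4 * (j%:Z - j'%:Z) by lia.
    have c4 : coprime ((2 * k + 1) ^ 2) (2 ^ 2).
      by rewrite coprimeXl // coprimeXr // coprimen2; lia.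
    by rewrite dvdzE abszM Gauss_dvdr; last exact: c4.
  rewrite -natr1 lerD2r ler_pdivlMr; last by rewrite exprn_gt0 // ltr0n addn1.
  by rewrite -natrX -natrM ler_nat leq_trunc_div.
have : (count P (iota 0 J) + count (predC P) (iota 0 J) = J)%N.
  by rewrite count_predC size_iota.
move=> /(congr1 (fun n : nat => n%:R : R)); rewrite natrD => cJ.
have c1R : (count P (iota 0 J))%:R <= (count sqfree_1mod4 (iota 0 N.+1))%:R :> R by rewrite ler_nat.
have NJR : N%:R <= 4 * J%:R :> R by rewrite -natrM ler_nat.
lra.
Qed.

(** * Cardinals and limits *)

Lemma ncardE (A : set nat) (N : nat) : (forall d, A d -> (d <= N)%N) ->
  ncard A = count (fun d => `[< A d >]) (iota 0 N.+1).
Proof.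
move=> AN; pose s := seq.filter (fun d => `[< A d >]) (iota 0 N.+1).
have sE : A = [set` s].
  apply/seteqP; split=> d /=; rewrite mem_filter mem_iota ltnS.
    by move=> Ad; apply/andP; split; [apply/asboolP|rewrite AN].
  by move=> /andP[/asboolP].
rewrite /ncard {1}sE -size_filter -/s.
have -> : fset_set [set` s] = [fset x in s]%fset.
  apply/fsetP => x; rewrite in_fset_set; last exact: finite_seq.
  by rewrite inE; apply/idP/idP; rewrite ?inE.
by rewrite card_fseq undup_id // filter_uniq // iota_uniq.
Qed.

Lemma le_ncard (A : set nat) (P Q : pred nat) (N : nat) :
  (forall d, A d -> (d <= N)%N) -> (forall d, A d -> P d || Q d) ->
  (ncard A <= count P (iota 0 N.+1) + count Q (iota 0 N.+1))%N.
Proof.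
move=> AN APQ; rewrite (ncardE AN) -count_predUI.
apply: leq_trans (leq_addr _ _); apply: sub_count => d /asboolP; exact: APQ.
Qed.

Lemma count_le_ncard (A : set nat) (P : pred nat) (N : nat) :
  (forall d, A d -> (d <= N)%N) -> (forall d, (d <= N)%N -> P d -> A d) ->
  (count P (iota 0 N.+1) <= ncard A)%N.
Proof.
move=> AN PA; rewrite (ncardE AN) -!size_filter.
apply: uniq_leq_size; first exact: filter_uniq (iota_uniq _ _).
move=> d; rewrite !mem_filter mem_iota ltnS => /andP[Pd /andP[_ dN]].
by rewrite dN !andbT; apply/asboolP; apply: PA.
Qed.

Lemma ceil_sqrt_le (R : realType) (N : nat) : (0 < N)%N ->
  exists s : nat, [/\ (N <= s ^ 2)%N, (0 < s)%N & s%:R <= 2 * Num.sqrt (N%:R : R)].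
Proof.
move=> N0; set w := Num.sqrt N%:R.
have w2 : w ^+ 2 = N%:R by rewrite sqr_sqrtr.
have w1 : 1 <= w by rewrite /w -[X in X <= _]sqrtr1 ler_sqrt // ler1n.
have /andP[tw wt] := truncn_itv (le_trans ler01 w1).
exists (Num.truncn w).+1; split=> //; last by rewrite -natr1; lra.
rewrite -(ler_nat R) -w2 natrX ler_sqr ?nnegrE ?ler0n ?(ltW wt) //.
exact: le_trans w1.
Qed.

Lemma small_pell_density0 (R : realType) (e : R) : 0 < e ->
  \forall N \near \oo,
    (count (fun d => `[< small_pell d >]) (iota 0 N.+1))%:R <= e * N%:R.
Proof.
move=> e0; have [C C0 CP] := count_small_pell_le R.
(* The count is at most 4 C N^(3/4), which is below e N once N^(1/4) >= K. *)
pose K := 4 * C / e.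
have K0 : 0 < K by rewrite divr_gt0 // mulr_gt0.
near=> N.
have NK : K ^+ 4 <= N%:R by near: N; apply: nbhs_infty_ger.
have N0 : (0 < N)%N by rewrite -(ltr_nat R); apply: lt_le_trans NK; rewrite exprn_gt0.
have [s [Ns s0 sw]] := ceil_sqrt_le R N0.
apply: (le_trans (CP _ _ Ns)).
set w := Num.sqrt N%:R in sw; set v := Num.sqrt s%:R; pose z := Num.sqrt w.
have z0 : 0 <= z by apply: sqrtr_ge0.
have zw : z ^+ 2 = w by rewrite sqr_sqrtr // sqrtr_ge0.
have wN : N%:R = z ^+ 4 by rewrite (exprM z 2 2) zw sqr_sqrtr.
have Kz : K <= z.
  rewrite leNgt; apply/negP => zK; move: NK; rewrite wN leNgt => /negP; apply.
  by rewrite ltrXn2r // ?nnegrE // ltW.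
have vz : v <= 2 * z.
  have -> : 2 * z = Num.sqrt ((2 * z) ^+ 2) by rewrite sqrtr_sqr ger0_norm // mulr_ge0.
  rewrite ler_sqrt ?sqr_ge0 // exprMn zw.
  have : 0 <= w by apply: sqrtr_ge0.
  by have := sw; lra.
have v0 : 0 <= v by apply: sqrtr_ge0.
have sv : s%:R * v <= 2 * w * (2 * z) by apply: ler_pM.
have ez : 4 * C <= e * z by rewrite [e * z]mulrC -ler_pdivrMr.
have e3 : 2 * w * (2 * z) = 4 * z ^+ 3 by rewrite -zw; ring.
rewrite -mulrA (le_trans (ler_wpM2l (ltW C0) sv)) // e3 wN [z ^+ 4]exprS mulrA [leRHS]mulrA.
by rewrite [C * 4]mulrC ler_wpM2r // exprn_ge0.
Unshelve. all: by end_near. Qed.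

Lemma sqfree_1mod4_density_pos (R : realType) :
  \forall N \near \oo, 1 / 16 * N%:R <= (count sqfree_1mod4 (iota 0 N.+1))%:R :> R.
Proof.
near=> N.
have N256 : 16 ^+ 2 <= N%:R :> R by near: N; apply: nbhs_infty_ger.
have N0 : (0 < N)%N by rewrite -(ltr_nat R); apply: lt_le_trans N256; rewrite exprn_gt0.
have [s [Ns s0 sw]] := ceil_sqrt_le R N0.
apply: le_trans (count_sqfree_1mod4_ge R N0 Ns).
set w := Num.sqrt N%:R in sw.
have w2 : w ^+ 2 = N%:R by rewrite sqr_sqrtr.
have w16 : 16 <= w.
  have -> : 16 = Num.sqrt (16 ^+ 2) :> R by rewrite sqrtr_sqr ger0_norm.
  by rewrite ler_sqrt.
have : 16 * w <= w ^+ 2 by rewrite expr2 ler_pM2r //; lra.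
rewrite w2; lra.
Unshelve. all: by end_near. Qed.

(** The gap between [u] and [v] is [o(N)] while [v] grows at least linearly. *)
Lemma cvg_ratio1 (R : realType) (u v : nat -> nat) :
  (forall N, u N <= v N)%N ->
  (forall N, v N <= u N + count (fun d => `[< small_pell d >]) (iota 0 N.+1))%N ->
  (forall N, count sqfree_1mod4 (iota 0 N.+1) <= v N)%N ->
  (u N)%:R / (v N)%:R @[N --> \oo] --> (1 : R).
Proof.
move=> uv vu sv; apply/cvgrPdist_le => e e0.
have e16 : 0 < e / 16 by rewrite divr_gt0.
near=> N.
have bN : (count (fun d => `[< small_pell d >]) (iota 0 N.+1))%:R <= e / 16 * N%:R.
  by near: N; apply: small_pell_density0.
have sN : 1 / 16 * N%:R <= (count sqfree_1mod4 (iota 0 N.+1))%:R :> R.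
  by near: N; apply: sqfree_1mod4_density_pos.
have N0 : (1 : R) <= N%:R by near: N; apply: nbhs_infty_ger.
have uvN : (u N)%:R <= (v N)%:R :> R by rewrite ler_nat.
have := vu N; rewrite -(ler_nat R) natrD => vuN.
have := sv N; rewrite -(ler_nat R) => svN.
have v0 : 0 < (v N)%:R :> R by lra.
have -> : 1 - (u N)%:R / (v N)%:R = ((v N)%:R - (u N)%:R) / (v N)%:R :> R.
  by rewrite mulrBl divff ?gt_eqF.
rewrite ger0_norm; last by rewrite divr_ge0 ?subr_ge0 // ltW.
rewrite ler_pdivrMr //.
have : e * (1 / 16 * N%:R) <= e * (v N)%:R by rewrite ler_pM2l //; lra.
lra.
Unshelve. all: by end_near. Qed.

Lemma cvg_truncn (R : realType) :
  Num.truncn (X : R) @[X --> +oo%R] --> \oo.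
Proof.
apply/(@cvgrnyP R); apply/cvgryPge => A; near=> X.
have X0 : 0 <= X by near: X; apply: nbhs_pinfty_ge; rewrite num_real.
have AX : A + 1 <= X by near: X; apply: nbhs_pinfty_ge; rewrite num_real.
have /andP[_] := truncn_itv X0; rewrite -natr1; lra.
Unshelve. all: by end_near. Qed.

(** The squarefree square [d = 1] satisfies [0^2 + 1 = d * 1^2], so it is
    absorbed by the exceptional set. *)
Lemma squarefree_leasts (R : realType) (i : bool) (d : nat) :
  squarefree d -> (i -> d = 1 %[mod 4])%N -> leasts R i d \/ small_pell d.
Proof.
move=> sf d1; have := squarefree_pos sf; rewrite leq_eqVlt => /orP[/eqP d11|d2].
  by right; exists 0%N, 1%N, 1%N; rewrite -d11; split=> //; left.
apply: leasts_or_small_pell d1; last exact: ltnW.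
exact: squarefree_nonsquare.
Qed.

Lemma leasts1_mod4 (R : realType) (d : nat) : leasts R true d -> (d %% 4 = 1)%N.
Proof.
move=> [y [x [[y0 _ _ _] [[D _] _]]]].
have [par /(DcaseE _ _ _ _ y0)[_ _ x2 [a0 [_ ac E]]]] : exists par, Dcase true par y x d.
  by case: D; [exists false|exists true].
exact: norm_eq_mod4 y0 x2 ac E.
Qed.

Definition sqfree_le (N : nat) : set nat :=
  [set d | (d <= N)%N /\ squarefree d].

Lemma sqfree_uptoE (R : realType) (X : R) :
  sqfree_upto X = sqfree_le (Num.truncn X).
Proof.
apply/seteqP; split=> d /=.
  move=> [d1 dX sf]; split=> //; rewrite truncn_ge_nat //.
  by apply: le_trans dX; rewrite ler0n.
move=> [dX sf]; have d0 := squarefree_pos sf; split=> //.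
have : (0 < Num.truncn X)%N by apply: leq_trans dX.
rewrite truncn_gt0 => X1; rewrite -truncn_ge_nat //.
exact: le_trans X1.
Qed.

Theorem corollary4p3 (R : realType) :
  [/\ (ncard (sqfree_upto (X : R) `&` leasts R false))%:R
        / (ncard (sqfree_upto X))%:R @[X --> +oo%R] --> (1 : R),
      (ncard (sqfree_upto (X : R) `&` leasts R true))%:R
        / (sqfree_count X 1 4)%:R @[X --> +oo%R] --> (1 : R) &
      (ncard [set d | [/\ (1 < d)%N, (d <= N)%N, squarefree d &
                          ~ least_type R d]])%:R / N%:R
        @[N --> \oo] --> (0 : R)].
Proof.
pose bad := fun d => `[< small_pell d >].
have badP (i : bool) d : squarefree d -> (i -> d = 1 %[mod 4])%N ->
    leasts R i d \/ bad d.
  by move=> sf /(squarefree_leasts R sf)[L|B]; [left|right; apply/asboolP].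
have le_sub (A B : set nat) N : (forall d, B d -> (d <= N)%N) -> A `<=` B ->
    (ncard A <= ncard B)%N.
  move=> BN AB; rewrite (ncardE BN) (ncardE (fun d Ad => BN d (AB d Ad))).
  by apply: sub_count => d /asboolP /AB Bd; apply/asboolP.
have le_bad (A B : set nat) N : (forall d, B d -> (d <= N)%N) -> A `<=` B ->
    (forall d, B d -> A d \/ bad d) ->
    (ncard B <= ncard A + count bad (iota 0 N.+1))%N.
  move=> BN AB AbadB; rewrite [ncard A](ncardE (fun d Ad => BN d (AB d Ad))).
  apply: le_ncard => // d /AbadB [Ad|->]; last by rewrite orbT.
  by apply/orP; left; apply/asboolP.
split.
- pose S N := sqfree_le N; pose L N := S N `&` leasts R false.
  have SN N d : S N d -> (d <= N)%N by case.
  have main : (ncard (L N))%:R / (ncard (S N))%:R @[N --> \oo] --> (1 : R).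
    apply: cvg_ratio1 => N.
    + by apply: (le_sub _ _ N) => [|d []]; [exact: SN|].
    + apply: le_bad => [|d []//|d Sd]; first exact: SN.
      by case: (badP false d Sd.2) => // Ld; [left|right].
    + by apply: count_le_ncard => [|d dN /asboolP[sf _]]; first exact: SN.
  under eq_cvg => X do rewrite sqfree_uptoE.
  exact: (cvg_comp _ _ (@cvg_truncn R) main).
- pose S N := [set d | sqfree_le N d /\ (d = 1 %[mod 4])%N].
  pose L N := sqfree_le N `&` leasts R true.
  have SN N d : S N d -> (d <= N)%N by case=> -[].
  have LS N : L N `<=` S N by move=> d [Sd Ld]; split=> //; rewrite (leasts1_mod4 Ld).
  have main : (ncard (L N))%:R / (ncard (S N))%:R @[N --> \oo] --> (1 : R).
    apply: cvg_ratio1 => N.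
    + by apply: (le_sub _ _ N); [exact: SN|exact: LS].
    + apply: le_bad => [| |d [Sd d1]]; [exact: SN|exact: LS|].
      by case: (badP true d Sd.2) => // Ld; [left|right].
    + by apply: count_le_ncard => [|d dN /asboolP[sf d1]]; first exact: SN.
  under eq_cvg => X do rewrite /sqfree_count sqfree_uptoE.
  exact: (cvg_comp _ _ (@cvg_truncn R) main).
- apply/cvgrPdist_le => e e0; near=> N.
  have bN : (count bad (iota 0 N.+1))%:R <= e * N%:R.
    by near: N; apply: small_pell_density0.
  have N0 : (1 : R) <= N%:R by near: N; apply: nbhs_infty_ger.
  rewrite sub0r normrN ger0_norm ?divr_ge0 // ler_pdivrMr; last by lra.
  apply: le_trans bN; rewrite ler_nat -[X in (_ <= X)%N]addn0.
  rewrite -[X in (_ <= _ + X)%N](count_pred0 (iota 0 N.+1)).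
  apply: le_ncard => [d []//|d [d1 _ sf nl]]; rewrite orbF; apply: contrapT => nb.
  apply: nl; case: (squarefree_mod4 sf) => dm.
  + by right; split=> //; case: (badP true d sf).
  + by left; split; [left|case: (badP false d sf)].
  + by left; split; [right|case: (badP false d sf)].
Unshelve. all: by end_near. Qed.
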